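(* Let $\mathbb{K}$ be an infinite field, $G$ an abelian group, $g\in G\setminus\{1\}$, and let $J\subseteq\mathcal{L}(X^G)$ be a $T_G$-ideal such that $\mathrm{Id}_G(\mathrm{UT}_3^{(-)}(\mathbb{K}),\Gamma(g,1))\subseteq J$. Then there exists a finite subset $S\subseteq\mathcal{L}(X^G)$ such that $$J=\langle S\rangle^{T_G}+\mathrm{Id}_G(\mathrm{UT}_3^{(-)},\Gamma(g,1)).$$
   Context: $\mathrm{UT}_3^{(-)}=\mathrm{UT}_3(\mathbb{K})^{(-)}$ is the Lie algebra of upper triangular $3\times3$ matrices over $\mathbb{K}$ with bracket $[a,b]=ab-ba$; $e_{ij}$ are matrix units. For an abelian group $G$ (multiplicative, neutral element $1$) and $g,h\in G$, $\Gamma(g,h)$ is the $G$-grading on $\mathrm{UT}_3^{(-)}$ with $\deg e_{ii}=1$, $\deg e_{12}=g$, $\deg e_{23}=h$, $\deg e_{13}=gh$. $\mathcal{L}(X^G)$ is the free $G$-graded Lie algebra over $\mathbb{K}$ freely generated by $X^G=\{x_{i,g}\mid i\in\mathbb{N},g\in G\}$ with $\deg x_{i,g}=g$. $\mathrm{Id}_G(\mathrm{UT}_3^{(-)},\Gamma)$ is the set of $f\in\mathcal{L}(X^G)$ that vanish under every graded homomorphism $\mathcal{L}(X^G)\to(\mathrm{UT}_3^{(-)},\Gamma)$. A $T_G$-ideal is an ideal of $\mathcal{L}(X^G)$ invariant under all graded endomorphisms, and $\langle S\rangle^{T_G}$ is the $T_G$-ideal generated by $S$. *)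

(* Defs.v *)
From HB Require Import structures.
From mathcomp Require Import all_boot all_order all_algebra.
From mathcomp Require Import boolp classical_sets functions cardinality.
From mathcomp Require Import ring.

Set Implicit Arguments.
Unset Strict Implicit.
Unset Printing Implicit Defensive.

Import GRing.Theory.
Local Open Scope ring_scope.
Local Open Scope classical_set_scope.
Local Open Scope quotient_scope.

HB.mixin Record Lmodule_isLie (K : pzRingType) L of GRing.Lmodule K L := {
  lie : L -> L -> L;
  lieDl : forall x y z, lie (x + y) z = lie x z + lie y z;
  lieDr : forall x y z, lie x (y + z) = lie x y + lie x z;
  lieZl : forall a x y, lie (a *: x) y = a *: lie x y;
  lieZr : forall a x y, lie x (a *: y) = a *: lie x y;
  liexx : forall x, lie x x = 0;
  lie_jacobi : forall x y z,
    lie x (lie y z) + lie y (lie z x) + lie z (lie x y) = 0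
}.

#[short(type="lieAlgType")]
HB.structure Definition LieAlgebra (K : pzRingType) :=
  {L of Lmodule_isLie K L & GRing.Lmodule K L}.

Definition lie_morphism (K : pzRingType) (L M : lieAlgType K)
    (f : {linear L -> M}) : Prop :=
  forall x y, f (lie x y) = lie (f x) (f y).

(* The free Lie algebra on X is the set of formal Lie expressions over X modulo
   the least congruence forced by the axioms of a Lie algebra. *)
Section FreeLie.
Variables (K : comNzRingType) (X : Type).

Inductive lterm : Type :=
| LVar of X
| LZero
| LAdd of lterm & lterm
| LOpp of lterm
| LScale of K & lterm
| LBr of lterm & lterm.

Inductive lcongr : lterm -> lterm -> Prop :=
| lc_refl s : lcongr s s
| lc_sym s t : lcongr s t -> lcongr t s
| lc_trans s t u : lcongr s t -> lcongr t u -> lcongr s u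
| lc_add s s' t t' : lcongr s s' -> lcongr t t' ->
    lcongr (LAdd s t) (LAdd s' t')
| lc_opp s s' : lcongr s s' -> lcongr (LOpp s) (LOpp s')
| lc_scale a s s' : lcongr s s' -> lcongr (LScale a s) (LScale a s')
| lc_br s s' t t' : lcongr s s' -> lcongr t t' ->
    lcongr (LBr s t) (LBr s' t')
| lc_addA s t u : lcongr (LAdd s (LAdd t u)) (LAdd (LAdd s t) u)
| lc_addC s t : lcongr (LAdd s t) (LAdd t s)
| lc_add0 s : lcongr (LAdd LZero s) s
| lc_addN s : lcongr (LAdd (LOpp s) s) LZero
| lc_scaleA a b s : lcongr (LScale a (LScale b s)) (LScale (a * b) s)
| lc_scale1 s : lcongr (LScale 1 s) s
| lc_scaleDr a s t :
    lcongr (LScale a (LAdd s t)) (LAdd (LScale a s) (LScale a t))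
| lc_scaleDl a b s :
    lcongr (LScale (a + b) s) (LAdd (LScale a s) (LScale b s))
| lc_brDl s t u : lcongr (LBr (LAdd s t) u) (LAdd (LBr s u) (LBr t u))
| lc_brDr s t u : lcongr (LBr s (LAdd t u)) (LAdd (LBr s t) (LBr s u))
| lc_brZl a s t : lcongr (LBr (LScale a s) t) (LScale a (LBr s t))
| lc_brZr a s t : lcongr (LBr s (LScale a t)) (LScale a (LBr s t))
| lc_brxx s : lcongr (LBr s s) LZero
| lc_jacobi s t u :
    lcongr (LAdd (LAdd (LBr s (LBr t u)) (LBr t (LBr u s))) (LBr u (LBr s t)))
           LZero.

HB.instance Definition _ := gen_eqMixin lterm.
HB.instance Definition _ := gen_choiceMixin lterm.

Definition lcongrb (s t : lterm) : bool := `[< lcongr s t >].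

Fact lcongrb_refl : reflexive lcongrb.
Proof. by move=> s; apply/asboolP; exact: lc_refl. Qed.

Fact lcongrb_sym : symmetric lcongrb.
Proof. by move=> s t; apply/asboolP/asboolP; exact: lc_sym. Qed.

Fact lcongrb_trans : transitive lcongrb.
Proof.
by move=> t s u /asboolP st /asboolP tu; apply/asboolP; exact: lc_trans st tu.
Qed.

Canonical lcongrb_equiv := EquivRel lcongrb lcongrb_refl lcongrb_sym lcongrb_trans.

Definition freeLie : Type := {eq_quot lcongrb}.

HB.instance Definition _ := Choice.on freeLie.
HB.instance Definition _ := Quotient.on freeLie.

Definition fl_pi (s : lterm) : freeLie := \pi_freeLie s.

Lemma fl_piP (s t : lterm) : fl_pi s = fl_pi t <-> lcongr s t.
Proof.
split=> [/(@eqmodP _ lcongrb_equiv)/asboolP //|st].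
by apply/(@eqmodP _ lcongrb_equiv)/asboolP.
Qed.

Lemma fl_reprK (u : freeLie) : fl_pi (repr u) = u.
Proof. exact: reprK. Qed.

Lemma fl_repr (s : lterm) : lcongr (repr (fl_pi s)) s.
Proof. by apply/fl_piP; rewrite fl_reprK. Qed.

Lemma fl_ind (P : freeLie -> Prop) : (forall s, P (fl_pi s)) -> forall u, P u.
Proof. by move=> Ps u; rewrite -(fl_reprK u). Qed.

Definition fl_add (u v : freeLie) := fl_pi (LAdd (repr u) (repr v)).
Definition fl_opp (u : freeLie) := fl_pi (LOpp (repr u)).
Definition fl_scale (a : K) (u : freeLie) := fl_pi (LScale a (repr u)).
Definition fl_br (u v : freeLie) := fl_pi (LBr (repr u) (repr v)).

Lemma fl_addE s t : fl_add (fl_pi s) (fl_pi t) = fl_pi (LAdd s t).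
Proof. by apply/fl_piP; apply: lc_add; exact: fl_repr. Qed.
Lemma fl_oppE s : fl_opp (fl_pi s) = fl_pi (LOpp s).
Proof. by apply/fl_piP; apply: lc_opp; exact: fl_repr. Qed.
Lemma fl_scaleE a s : fl_scale a (fl_pi s) = fl_pi (LScale a s).
Proof. by apply/fl_piP; apply: lc_scale; exact: fl_repr. Qed.
Lemma fl_brE s t : fl_br (fl_pi s) (fl_pi t) = fl_pi (LBr s t).
Proof. by apply/fl_piP; apply: lc_br; exact: fl_repr. Qed.
Let flE := (fl_addE, fl_oppE, fl_scaleE, fl_brE).

Fact fl_addA : associative fl_add.
Proof.
elim/fl_ind=> s; elim/fl_ind=> t; elim/fl_ind=> u; rewrite !flE.
by apply/fl_piP; exact: lc_addA.
Qed.
Fact fl_addC : commutative fl_add.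
Proof.
elim/fl_ind=> s; elim/fl_ind=> t; rewrite !flE.
by apply/fl_piP; exact: lc_addC.
Qed.
Fact fl_add0 : left_id (fl_pi LZero) fl_add.
Proof. by elim/fl_ind=> s; rewrite !flE; apply/fl_piP; exact: lc_add0. Qed.
Fact fl_addN : left_inverse (fl_pi LZero) fl_opp fl_add.
Proof. by elim/fl_ind=> s; rewrite !flE; apply/fl_piP; exact: lc_addN. Qed.

HB.instance Definition _ :=
  GRing.isZmodule.Build freeLie fl_addA fl_addC fl_add0 fl_addN.

Fact fl_scaleA a b u : fl_scale a (fl_scale b u) = fl_scale (a * b) u.
Proof. by elim/fl_ind: u => s; rewrite !flE; apply/fl_piP; exact: lc_scaleA. Qed.
Fact fl_scale1 : left_id 1 fl_scale.
Proof. by elim/fl_ind=> s; rewrite !flE; apply/fl_piP; exact: lc_scale1. Qed.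
Fact fl_scaleDr : right_distributive fl_scale +%R.
Proof.
move=> a; elim/fl_ind=> s; elim/fl_ind=> t; rewrite /GRing.add /= !flE.
by apply/fl_piP; exact: lc_scaleDr.
Qed.
Fact fl_scaleDl u : {morph fl_scale^~ u : a b / a + b >-> a + b}.
Proof.
move=> a b; elim/fl_ind: u => s; rewrite [RHS]/GRing.add /= !flE.
by apply/fl_piP; exact: lc_scaleDl.
Qed.

HB.instance Definition _ := GRing.Zmodule_isLmodule.Build K freeLie
  fl_scaleA fl_scale1 fl_scaleDr fl_scaleDl.

Lemma fl_piD s t : fl_pi (LAdd s t) = fl_pi s + fl_pi t.
Proof. by rewrite -fl_addE. Qed.
Lemma fl_piN s : fl_pi (LOpp s) = - fl_pi s.
Proof. by rewrite -fl_oppE. Qed.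
Lemma fl_pi0 : fl_pi LZero = 0.
Proof. by []. Qed.
Lemma fl_piZ a s : fl_pi (LScale a s) = a *: fl_pi s.
Proof. by rewrite -fl_scaleE. Qed.
Let piE := (fl_piD, fl_piN, fl_piZ).

Fact fl_brDl u v w : fl_br (u + v) w = fl_br u w + fl_br v w.
Proof.
elim/fl_ind: u => s; elim/fl_ind: v => t; elim/fl_ind: w => r.
by rewrite -fl_piD !fl_brE -fl_piD; apply/fl_piP; exact: lc_brDl.
Qed.
Fact fl_brDr u v w : fl_br u (v + w) = fl_br u v + fl_br u w.
Proof.
elim/fl_ind: u => s; elim/fl_ind: v => t; elim/fl_ind: w => r.
by rewrite -fl_piD !fl_brE -fl_piD; apply/fl_piP; exact: lc_brDr.
Qed.
Fact fl_brZl a u v : fl_br (a *: u) v = a *: fl_br u v.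
Proof.
elim/fl_ind: u => s; elim/fl_ind: v => t.
by rewrite -fl_piZ !fl_brE -fl_piZ; apply/fl_piP; exact: lc_brZl.
Qed.
Fact fl_brZr a u v : fl_br u (a *: v) = a *: fl_br u v.
Proof.
elim/fl_ind: u => s; elim/fl_ind: v => t.
by rewrite -fl_piZ !fl_brE -fl_piZ; apply/fl_piP; exact: lc_brZr.
Qed.
Fact fl_brxx u : fl_br u u = 0.
Proof. by elim/fl_ind: u => s; rewrite fl_brE; apply/fl_piP; exact: lc_brxx. Qed.
Fact fl_br_jacobi u v w :
  fl_br u (fl_br v w) + fl_br v (fl_br w u) + fl_br w (fl_br u v) = 0.
Proof.
elim/fl_ind: u => s; elim/fl_ind: v => t; elim/fl_ind: w => r.
by rewrite !fl_brE -!fl_piD; apply/fl_piP; exact: lc_jacobi.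
Qed.

HB.instance Definition _ := Lmodule_isLie.Build K freeLie
  fl_brDl fl_brDr fl_brZl fl_brZr fl_brxx fl_br_jacobi.

Definition fl_var (x : X) : freeLie := fl_pi (LVar x).

Lemma fl_pi_lie s t : fl_pi (LBr s t) = lie (fl_pi s) (fl_pi t).
Proof. by rewrite -fl_brE. Qed.

End FreeLie.

Section UniversalProperty.
Variables (K : comNzRingType) (X : Type) (M : lieAlgType K) (f : X -> M).

Fixpoint lterm_eval (s : lterm K X) : M :=
  match s with
  | LVar x => f x
  | LZero => 0
  | LAdd s t => lterm_eval s + lterm_eval t
  | LOpp s => - lterm_eval s
  | LScale a s => a *: lterm_eval s
  | LBr s t => lie (lterm_eval s) (lterm_eval t)
  end.

Lemma lterm_evalP s t : lcongr s t -> lterm_eval s = lterm_eval t.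
Proof.
elim=> //= {s t}.
- by move=> s t u _ -> _ ->.
- by move=> s s' t t' _ -> _ ->.
- by move=> s s' _ ->.
- by move=> a s s' _ ->.
- by move=> s s' t t' _ -> _ ->.
- by move=> *; rewrite addrA.
- by move=> *; rewrite addrC.
- by move=> *; rewrite add0r.
- by move=> *; rewrite addNr.
- by move=> *; rewrite scalerA.
- by move=> *; rewrite scale1r.
- by move=> *; rewrite scalerDr.
- by move=> *; rewrite scalerDl.
- by move=> *; rewrite lieDl.
- by move=> *; rewrite lieDr.
- by move=> *; rewrite lieZl.
- by move=> *; rewrite lieZr.
- by move=> *; rewrite liexx.
- by move=> *; rewrite lie_jacobi.
Qed.

Definition fl_lift (u : freeLie K X) : M := lterm_eval (repr u).

Lemma fl_lift_pi s : fl_lift (fl_pi s) = lterm_eval s.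
Proof. by apply: lterm_evalP; exact: fl_repr. Qed.

Fact fl_lift_linear : linear fl_lift.
Proof.
move=> a; elim/fl_ind=> s; elim/fl_ind=> t.
by rewrite -fl_piZ -fl_piD !fl_lift_pi.
Qed.

HB.instance Definition _ :=
  GRing.isLinear.Build K (freeLie K X) M _ fl_lift fl_lift_linear.

Lemma fl_lift_lie : lie_morphism fl_lift.
Proof.
by elim/fl_ind=> s; elim/fl_ind=> t; rewrite -fl_pi_lie /= !fl_lift_pi.
Qed.

Lemma fl_lift_var x : fl_lift (fl_var K x) = f x.
Proof. by rewrite fl_lift_pi. Qed.

Lemma fl_lift_unique (phi : {linear freeLie K X -> M}) :
  lie_morphism phi -> (forall x, phi (fl_var K x) = f x) -> phi =1 fl_lift.
Proof.
move=> phiM phiX; elim/fl_ind=> s; rewrite fl_lift_pi.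
elim: s => //= [|s IHs t IHt|s IHs|a s IHs|s IHs t IHt].
- by rewrite fl_pi0 linear0.
- by rewrite fl_piD linearD IHs IHt.
- by rewrite fl_piN linearN IHs.
- by rewrite fl_piZ linearZ /= IHs.
- by rewrite fl_pi_lie phiM IHs IHt.
Qed.

End UniversalProperty.

(* A G-grading of L is given by its family of homogeneous components
   d : G -> set L. *)
Section Graded.
Variables (K : pzRingType) (G : Type).

Definition graded_hom (L M : lieAlgType K) (dL : G -> set L) (dM : G -> set M)
    (f : {linear L -> M}) : Prop :=
  lie_morphism f /\ forall k x, dL k x -> dM k (f x).

Definition graded_identities (L M : lieAlgType K) (dL : G -> set L)
    (dM : G -> set M) : set L :=
  [set u | forall f : {linear L -> M}, graded_hom dL dM f -> f u = 0].

Definition lie_ideal (L : lieAlgType K) (J : set L) : Prop :=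
  [/\ J 0,
      forall x y, J x -> J y -> J (x + y),
      forall a x, J x -> J (a *: x) &
      forall x y, J y -> J (lie x y)].

Definition TG_ideal (L : lieAlgType K) (d : G -> set L) (J : set L) : Prop :=
  lie_ideal J /\
  forall f : {linear L -> L}, graded_hom d d f -> forall u, J u -> J (f u).

Definition TG_generated (L : lieAlgType K) (d : G -> set L) (S : set L) :
    set L :=
  [set u | forall J, TG_ideal d J -> S `<=` J -> J u].

End Graded.

Definition add_set (V : nmodType) (A B : set V) : set V :=
  [set a + b | a in A & b in B].

(* L(X^G); the generator x_(i,k) is indexed by the pair (i, k). *)
Notation freeGLie K G := (freeLie K (nat * G)).

Section FreeGradedLie.
Variables (K : comNzRingType) (G : groupType).

Definition gvar (i : nat) (k : G) : freeGLie K G := fl_var K (i, k).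

(* the homogeneous components of L(X^G): the least family of subspaces that
   contains x_(i,k) in degree k and is compatible with the bracket *)
Inductive fl_homog : G -> set (freeGLie K G) :=
| fl_homog_var i k : fl_homog k (gvar i k)
| fl_homog0 k : fl_homog k 0
| fl_homogD k u v : fl_homog k u -> fl_homog k v -> fl_homog k (u + v)
| fl_homogZ k a u : fl_homog k u -> fl_homog k (a *: u)
| fl_homog_lie k l u v :
    fl_homog k u -> fl_homog l v -> fl_homog (k * l)%g (lie u v).

End FreeGradedLie.

Section UpperTriangular.
Variables (K : comNzRingType) (n : nat).

(* mathcomp's is_trig_mx means lower triangular *)
Definition upper_trig : {pred 'M[K]_n} := [pred A | is_trig_mx A^T].

Lemma upper_trigP (A : 'M[K]_n) :
  reflect (forall i j : 'I_n, (j < i)%N -> A i j = 0) (A \in upper_trig).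
Proof.
apply: (iffP is_trig_mxP) => A0 i j ij; first by rewrite -(A0 j i) // mxE.
by rewrite mxE A0.
Qed.

Fact upper_trig_submod : submod_closed upper_trig.
Proof.
split=> [|a A B /upper_trigP A0 /upper_trigP B0].
  by apply/upper_trigP => i j _; rewrite mxE.
by apply/upper_trigP => i j ij; rewrite !mxE A0 // B0 // mulr0 addr0.
Qed.

HB.instance Definition _ :=
  GRing.isSubmodClosed.Build K 'M[K]_n upper_trig upper_trig_submod.

Record UT := MkUT { ut_mx :> 'M[K]_n; ut_mxP : ut_mx \in upper_trig }.

HB.instance Definition _ := [isSub for ut_mx].
HB.instance Definition _ := [Choice of UT by <:].
HB.instance Definition _ := [SubChoice_isSubLmodule of UT by <:].

Lemma upper_trigM (A B : 'M[K]_n) :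
  A \in upper_trig -> B \in upper_trig -> A *m B \in upper_trig.
Proof.
move=> /upper_trigP A0 /upper_trigP B0; apply/upper_trigP => i j ij.
rewrite mxE big1 // => k _; have [ki|ik] := ltnP k i; first by rewrite A0 ?mul0r.
by rewrite B0 ?mulr0 //; exact: leq_trans ij ik.
Qed.

Fact ut_br_subproof (A B : UT) : A *m B - B *m A \in upper_trig.
Proof. by rewrite rpredB // upper_trigM // ut_mxP. Qed.

Definition ut_br (A B : UT) : UT := MkUT (ut_br_subproof A B).

Fact ut_brDl A B C : ut_br (A + B) C = ut_br A C + ut_br B C.
Proof.
by apply: val_inj; rewrite /= mulmxDl mulmxDr opprD addrACA.
Qed.
Fact ut_brDr A B C : ut_br A (B + C) = ut_br A B + ut_br A C.
Proof.
by apply: val_inj; rewrite /= mulmxDl mulmxDr opprD addrACA.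
Qed.
Fact ut_brZl a A B : ut_br (a *: A) B = a *: ut_br A B.
Proof.
by apply: val_inj; rewrite /= -scalemxAl -scalemxAr scalerBr.
Qed.
Fact ut_brZr a A B : ut_br A (a *: B) = a *: ut_br A B.
Proof.
by apply: val_inj; rewrite /= -scalemxAl -scalemxAr scalerBr.
Qed.
Fact ut_brxx A : ut_br A A = 0.
Proof. by apply: val_inj; rewrite /= subrr. Qed.
Fact ut_br_jacobi A B C :
  ut_br A (ut_br B C) + ut_br B (ut_br C A) + ut_br C (ut_br A B) = 0.
Proof.
apply: val_inj; rewrite /= !(mulmxBl, mulmxBr) !mulmxA.
by apply/matrixP => i j; rewrite !mxE; ring.
Qed.

HB.instance Definition _ := Lmodule_isLie.Build K UT
  ut_brDl ut_brDr ut_brZl ut_brZr ut_brxx ut_br_jacobi.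

End UpperTriangular.

Section Gamma.
Variables (K : comNzRingType) (G : groupType).

(* degree of the matrix unit e_(i+1)(j+1); only meaningful for i <= j *)
Definition ut3_deg (g h : G) (i j : 'I_3) : G :=
  match nat_of_ord i, nat_of_ord j with
  | 0, 1 => g
  | 1, 2 => h
  | 0, 2 => (g * h)%g
  | _, _ => 1%g
  end%N.

(* component of degree k of Gamma(g,h): the span of the e_ij of degree k *)
Definition Gamma (g h : G) (k : G) : set (UT K 3) :=
  [set A : UT K 3 | forall i j : 'I_3,
    (i <= j)%N -> A i j != 0 -> ut3_deg g h i j = k].

End Gamma.

(* Main.v *)
Require Import Defs.
From HB Require Import structures.
From mathcomp Require Import all_boot all_algebra.
From mathcomp Require Import boolp classical_sets cardinality.
From mathcomp Require Import ring.

(** For the grading Gamma(g,1), the degree 1 part of UT_3 is the diagonal plus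
    e_23, the degree g part is spanned by e_12 and e_13, and all other parts
    vanish. Write y_i and z_i for the variables of degree 1 and g, and let
    products denote left-normed brackets. Modulo the identities, L(X^G) is
    spanned by four families of monomials:
      z_l y^a,  z_l y^a [y_i,y_j] y^b,  y_i,  [y_i,y_j] y^b,
    where the y's of the second and fourth family commute, and those of the first
    commute up to elements of the second. Each family is treated by a Groebner
    basis argument modulo the later ones: monomials are ordered
    lexicographically, and increasing renamings of the indices, bracketing by
    y's and the substitution z |-> [z,y] act on monomials monotonically.
    Divisibility under these operations is an embedding of words of exponent
    vectors, hence a well-quasi-order by Higman's lemma, so the leading monomials
    of J are generated by finitely many. The spanning families need not be
    linearly independent, and J need not be split into homogeneous components. *)

Set Implicit Arguments.
Unset Strict Implicit.
Unset Printing Implicit Defensive.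

(** * Well-quasi-orders and Higman's lemma *)

Definition wqo (T : Type) (le : T -> T -> Prop) :=
  forall s : nat -> T, exists i j, (i < j)%N /\ le (s i) (s j).

(** Beyond some index every term lies below a later one: otherwise the terms lying below no later
    one would form a sequence contradicting [wqo]. Iterating from that index and using transitivity
    gives the subsequence. *)
Lemma wqo_increasing_subseq (T : Type) (le : T -> T -> Prop) (s : nat -> T) :
  wqo le -> (forall x y z, le x y -> le y z -> le x z) ->
  exists h : nat -> nat, {homo h : i j / (i < j)%N} /\
    forall i j, (i < j)%N -> le (s (h i)) (s (h j)).
Proof.
move=> le_wqo le_trans.
have [N HN] : exists N, forall i, (N <= i)%N ->
    exists j, (i < j)%N /\ le (s i) (s j).
  apply: contrapT => /forallNP H.
  have /choice[f Hf] : forall N, exists i, (N <= i)%N /\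
      forall j, (i < j)%N -> ~ le (s i) (s j).
    move=> N; have /existsNP[i /not_implyP[Ni Hi]] := H N.
    by exists i; split=> // j ij sij; apply: Hi; exists j.
  pose g n := iter n (fun i => f i.+1) (f 0).
  have gS n : (g n < g n.+1)%N by rewrite /g iterS; have [] := Hf (g n).+1.
  have [i [j [ij]]] := le_wqo (s \o g).
  have gP n : forall j, (g n < j)%N -> ~ le (s (g n)) (s j).
    by case: n => [|n] j'; [have [_] := Hf 0 | have [_] := Hf (g n).+1]; apply.
  by apply: gP; apply: (homo_ltn ltn_trans gS).
have /choice[t Ht] : forall i, exists j, (N <= i)%N -> (i < j)%N /\ le (s i) (s j).
  move=> i; have [Ni|_] := boolP (N <= i)%N; last by exists 0.
  by have [j] := HN i Ni; exists j.
pose h n := iter n t N.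
have hN n : (N <= h n)%N.
  by elim: n => //= n IHn; have [/ltnW le_ht _] := Ht _ IHn; apply: leq_trans IHn le_ht.
have hS n : (h n < h n.+1)%N by have [] := Ht _ (hN n).
exists h; split; first exact: (homo_ltn ltn_trans hS).
move=> i; elim=> // j IHj; rewrite ltnS leq_eqVlt => /predU1P[->|/IHj ij].
  by have [] := Ht _ (hN j).
by apply: le_trans ij _; have [] := Ht _ (hN j).
Qed.

Lemma wqo_leq : wqo (fun m n => is_true (m <= n)%N).
Proof.
move=> s; pose P n := `[< exists i, s i = n >].
have Pex : exists n, P n by exists (s 0); apply/asboolP; exists 0.
case: (ex_minnP Pex) => _ /asboolP[i <-] s_min; exists i, i.+1; split=> //.
by apply: s_min; apply/asboolP; exists i.+1.
Qed.

(** Dickson's lemma. Along a subsequence increasing in the first [k] coordinates, [wqo_leq] is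
    applied to coordinate [k]. *)
Lemma dickson k :
  wqo (fun a b : nat -> nat => forall r, (r < k)%N -> (a r <= b r)%N).
Proof.
elim: k => [|k IHk] s; first by exists 0, 1.
have le_tr (x y z : nat -> nat) : (forall r, r < k -> x r <= y r)%N ->
    (forall r, r < k -> y r <= z r)%N -> forall r, (r < k -> x r <= z r)%N.
  by move=> xy yz r rk; apply: leq_trans (xy r rk) (yz r rk).
have [h [h_mono h_le]] := wqo_increasing_subseq s IHk le_tr.
have [i [j [ij le_ij]]] := wqo_leq (fun n => s (h n) k).
exists (h i), (h j); split; first exact: h_mono.
by move=> r; rewrite ltnS leq_eqVlt => /predU1P[->|]//; apply: h_le.
Qed.

Section Higman.
Variables (T : Type) (x0 : T) (le : T -> T -> Prop).
Hypothesis le_trans : forall x y z, le x y -> le y z -> le x z.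
Hypothesis le_wqo : wqo le.

(** The map [h] is strictly increasing on all of [nat], not only on the positions of [u], so that it
    can later rename all variables. *)
Definition emb (u v : seq T) := exists2 h : nat -> nat,
  {homo h : i j / (i < j)%N} &
  forall i, (i < size u)%N ->
    (h i < size v)%N /\ le (nth x0 u i) (nth x0 v (h i)).

Lemma emb_nil v : emb [::] v.
Proof. by exists id. Qed.

Lemma emb_skip u y v : emb u v -> emb u (y :: v).
Proof.
move=> [h h_mono hP]; exists (fun i => (h i).+1) => //.
Qed.

Lemma emb_cons x u y v : le x y -> emb u v -> emb (x :: u) (y :: v).
Proof.
move=> xy [h h_mono hP].
exists (fun i => if i is i'.+1 then (h i').+1 else 0).
  by move=> [|i] [|j] //= ij; apply: h_mono.
by move=> [|i] //= iu; have [] := hP i iu.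
Qed.

Definition bad (s : nat -> seq T) := forall i j, (i < j)%N -> ~ emb (s i) (s j).

Definition extendable (p : seq (seq T)) := exists2 s, bad s & mkseq s (size p) = p.

(** Picks the next entry of a minimal bad sequence. It is stated for every [p] so that [choice]
    yields a function; the empty word is a dummy value. *)
Lemma extendable_next p : exists w, extendable p ->
  extendable (rcons p w) /\
  forall v, (size v < size w)%N -> ~ extendable (rcons p v).
Proof.
have [px|] := pselect (extendable p); last by exists [::].
pose P n := `[< exists2 w, extendable (rcons p w) & size w = n >].
have Pex : exists n, P n.
  have [s s_bad sp] := px; exists (size (s (size p))); apply/asboolP.
  exists (s (size p)) => //; exists s => //.
  by rewrite size_rcons mkseqS sp.
case: (ex_minnP Pex) => _ /asboolP[w pw <-] w_min; exists w => _; split=> // v.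
rewrite ltnNge => /negP vw pv; apply: vw.
by apply: w_min; apply/asboolP; exists v.
Qed.

(* Nash-Williams' minimal bad sequence argument. *)
Lemma higman : wqo emb.
Proof.
move=> s0; apply: contrapT => s0_bad.
have [next nextP] := choice extendable_next.
pose pref n := iter n (fun p => rcons p (next p)) [::].
pose m n := next (pref n).
have prefE n : pref n = mkseq m n by elim: n => // n IHn; rewrite mkseqS -IHn.
have prefx n : extendable (pref n).
  elim: n => [|n /nextP[]//]; exists s0 => // i j ij sij.
  by apply: s0_bad; exists i, j.
have m_min n v : (size v < size (m n))%N -> ~ extendable (rcons (mkseq m n) v).
  by rewrite -prefE; have [_] := nextP _ (prefx n); apply.
have m_bad : bad m.
  move=> i j ij; have [s s_bad] := prefx j.+1.
  rewrite prefE size_mkseq => sm.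
  have smE k : (k <= j)%N -> s k = m k.
    by move=> kj; rewrite -(nth_mkseq [::] s (n := j.+1)) // sm nth_mkseq.
  by rewrite -(smE i) ?(ltnW ij) // -(smE j) //; apply: s_bad.
(* The empty word embeds in every word, so no word of a bad sequence is empty. *)
have m_cons n : m n = head x0 (m n) :: behead (m n).
  case E: (m n) => [|x u] //.
  by case: (m_bad n n.+1 (leqnn _)); rewrite E; apply: emb_nil.
have [h [h_mono h_le]] :=
  wqo_increasing_subseq (fun n => head x0 (m n)) le_wqo le_trans.
(* Keep [m] before position [h 0] and continue with the tails of the words whose heads increase.
   This sequence is bad, yet shorter at position [h 0]. *)
pose t i := if (i < h 0)%N then m i else behead (m (h (i - h 0))).
apply: (m_min (h 0) (behead (m (h 0)))); first by rewrite [X in (_ < size X)%N]m_cons.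
exists t; last first.
  rewrite size_rcons size_mkseq mkseqS; congr rcons.
    by apply/eq_in_map => i; rewrite mem_iota /= add0n /t => ->.
  by rewrite /t ltnn subnn.
move=> i j ij; rewrite /t; have [jh|hj] := ltnP j (h 0).
  by rewrite (ltn_trans ij jh); apply: m_bad.
have [ih|hi] := ltnP i (h 0) => E.
  apply: (m_bad i (h (j - h 0))).
    apply: leq_trans ih _; case: (j - h 0)%N => // k.
    by apply/ltnW/h_mono.
  by rewrite (m_cons (h _)); apply: emb_skip.
have ij' : (i - h 0 < j - h 0)%N by rewrite ltn_sub2r // (leq_ltn_trans hi ij).
apply: (m_bad _ _ (h_mono _ _ ij')).
by rewrite (m_cons (h (i - _))) (m_cons (h (j - _))); apply: emb_cons; first exact: h_le.
Qed.

End Higman.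

(** If every finite list from [A] left some element of [A] above none of its members, adjoining such
    elements one by one would give a sequence contradicting [wqo]. *)
Lemma wqo_finite_basis (T : eqType) (le : T -> T -> Prop) (A : T -> Prop) :
  wqo le -> exists p : seq T, (forall b, b \in p -> A b) /\
    forall a, A a -> exists2 b, b \in p & le b a.
Proof.
move=> le_wqo; apply: contrapT => noF.
have /choice[a aP] : forall p : seq T, exists a, (forall b, b \in p -> A b) ->
    A a /\ forall b, b \in p -> ~ le b a.
  move=> p; have [pA|] := pselect (forall b, b \in p -> A b); last first.
    have [[a _] nA|noT nA] := pselect (exists a : T, True); first by exists a.
    by case: p nA => [|b p] nA; [case: nA | case: noT; exists b].
  apply: contrapT => /forallNP noa; apply: noF; exists p; split=> // a Aa.
  apply: contrapT => a_min; apply: (noa a) => _; split=> // b bp ba.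
  by apply: a_min; exists b.
pose pref n := iter n (fun p => a p :: p) [::].
have prefA n : forall b, b \in pref n -> A b.
  by elim: n => [|n IHn] b //=; rewrite inE => /predU1P[->|]; [have [] := aP _ IHn | apply: IHn].
have [i [j [ij]]] := le_wqo (fun n => a (pref n)).
have [_] := aP _ (prefA j); apply.
elim: j ij => // j IHj; rewrite ltnS leq_eqVlt => /predU1P[->|/IHj ij].
  exact: mem_head.
by rewrite inE ij orbT.
Qed.

(** * Monomials as multisets and their lexicographic order *)

(* The first differing exponent decides. *)
Definition mlt (m m' : seq nat) := exists2 x, (count_mem x m < count_mem x m')%N &
  forall y, (y < x)%N -> count_mem y m = count_mem y m'.

Lemma mlt_trans m1 m2 m3 : mlt m1 m2 -> mlt m2 m3 -> mlt m1 m3.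
Proof.
move=> [x lt12 eq12] [y lt23 eq23]; have [xy|yx|xy] := ltngtP x y.
- exists x; first by rewrite -eq23.
  by move=> z zx; rewrite eq12 ?eq23 // (ltn_trans zx).
- exists y; first by rewrite eq12.
  by move=> z zy; rewrite eq12 ?eq23 // (ltn_trans zy).
- exists x; first by apply: ltn_trans lt12 _; rewrite xy.
  by move=> z zx; rewrite eq12 ?eq23 // -xy.
Qed.

Lemma mlt_total m m' : [\/ mlt m m', mlt m' m | perm_eq m m'].
Proof.
have [diff|] := pselect (exists x, count_mem x m != count_mem x m'); last first.
  move=> /forallNP eq_m; constructor 3; apply/allP => x _ /=.
  by apply/negPn/negP; apply: eq_m.
case: (ex_minnP diff) => x; rewrite neq_ltn => lt_x x_min.
have eq_lt y : (y < x)%N -> count_mem y m = count_mem y m'.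
  by rewrite ltnNge => yx; apply/eqP; apply: contraNT yx => /x_min.
by case/orP: lt_x => lt_x; [constructor 1 | constructor 2]; exists x => // y /eq_lt.
Qed.

Lemma mlt_perm m m1 m2 : perm_eq m1 m2 -> mlt m m1 -> mlt m m2.
Proof.
move=> /permP m12 [x lt_x eq_x]; exists x; first by rewrite -m12.
by move=> y /eq_x ->.
Qed.

(** For entries below [N] this is the lexicographic order on [N] exponents, hence well founded.
    Without the bound, the one-element multisets of 0, 1, 2, ... descend forever. *)
Lemma mlt_ind (N : nat) (P : seq nat -> Prop) :
  (forall m, all (ltn^~ N) m ->
     (forall m', all (ltn^~ N) m' -> mlt m' m -> P m') -> P m) ->
  forall m, all (ltn^~ N) m -> P m.
Proof.
move=> step.
(* [R x] ignores the exponents before [x]. It is empty for [x = N], and well-foundedness is carried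
   from there down to [x = 0]. *)
pose R x m' m := exists y, [/\ (x <= y)%N, (y < N)%N, (count_mem y m' < count_mem y m)%N
  & forall z, (x <= z < y)%N -> count_mem z m' = count_mem z m].
have wfR d : (d <= N)%N -> forall m, Acc (R (N - d)%N) m.
  elim: d => [_ m|d IHd dN m].
    by constructor=> m' [y [Ny yN]]; rewrite subn0 in Ny; rewrite ltnNge Ny in yN.
  move: {IHd}(IHd (ltnW dN)); rewrite -(subnSK dN); move: (N - d.+1)%N => x IHd.
  have [n] := ubnP (count_mem x m); elim: n m => [|n IHn] m; first by rewrite ltn0.
  elim: {m}(IHd m) => m _ IHm mn; constructor=> m' [y [xy yN lt_y eq_y]].
  (* Either the exponent of [x] drops, or it is kept and a later exponent drops. *)
  move: xy; rewrite leq_eqVlt => /predU1P[xy|xy].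
    by apply: IHn; rewrite xy; apply: leq_trans lt_y _; rewrite -xy.
  apply: IHm; last by rewrite eq_y // leqnn.
  exists y; split=> // z /andP[xz zy]; apply: eq_y; rewrite zy andbT.
  exact: ltnW.
move=> m; elim: {m}(wfR N (leqnn N) m) => m _ IHm m_bd.
apply: step => // m' m'_bd m'm; apply: IHm => //.
have [x lt_x eq_x] := m'm; exists x; rewrite subnn; split=> //.
  have /hasP[y ym /eqP<-] : has (pred1 x) m by rewrite has_count (leq_ltn_trans _ lt_x).
  exact: (allP m_bd).
Qed.

Lemma count_map_inj (f : nat -> nat) (m : seq nat) x :
  injective f -> count_mem (f x) (map f m) = count_mem x m.
Proof. by move=> f_inj; rewrite count_map; apply: eq_count => y /=; rewrite inj_eq. Qed.

Lemma count_map_notin (f : nat -> nat) (m : seq nat) y :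
  ~ (exists x, f x = y) -> count_mem y (map f m) = 0%N.
Proof.
move=> fy; apply/count_memPn/negP => /mapP[x _ yx].
by apply: fy; exists x.
Qed.

(* An entry [x] of a monomial stands for the variable with index [x %/ k] in
   role [x %% k]; [lift_idx] renames variables and keeps roles. *)
Section Lift.
Variables (k : nat) (h : nat -> nat).
Hypotheses (k_gt0 : (0 < k)%N) (h_mono : {homo h : i j / (i < j)%N}).

Definition lift_idx x := (h (x %/ k) * k + x %% k)%N.

Lemma lift_idx_div x : (lift_idx x %/ k = h (x %/ k))%N.
Proof. by rewrite /lift_idx divnMDl // (divn_small (ltn_pmod _ k_gt0)) addn0. Qed.

Lemma lift_idx_mod x : (lift_idx x %% k = x %% k)%N.
Proof. by rewrite /lift_idx modnMDl modn_mod. Qed.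

Lemma lift_idx_mono : {homo lift_idx : x y / (x < y)%N}.
Proof.
move=> x y xy; have [lt_xy|le_yx] := ltnP (x %/ k) (y %/ k).
  apply: (@leq_trans ((h (x %/ k)).+1 * k)).
    by rewrite /lift_idx mulSn addnC -addSn leq_add2r ltn_mod.
  by apply: leq_trans (leq_addr _ _); rewrite leq_mul2r h_mono ?orbT.
have eq_xy : (x %/ k = y %/ k)%N.
  by apply/eqP; rewrite eqn_leq le_yx andbT leq_div2r // ltnW.
rewrite /lift_idx eq_xy ltn_add2l.
by move: xy; rewrite {1}(divn_eq x k) {1}(divn_eq y k) eq_xy ltn_add2l.
Qed.

Lemma lift_idx_inj : injective lift_idx.
Proof. exact: incn_inj (leq_mono lift_idx_mono). Qed.

(** An increasing relabelling carries the first differing entry to the first differing entry;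
    entries outside its image are counted in [c] only. *)
Lemma mlt_op c m m' : mlt m m' -> mlt (map lift_idx m ++ c) (map lift_idx m' ++ c).
Proof.
have li := lift_idx_inj.
move=> [x lt_x eq_x]; exists (lift_idx x).
  by rewrite !count_cat !count_map_inj // ltn_add2r.
move=> y yx; rewrite !count_cat; congr (_ + _)%N.
have [[z zy]|ny] := pselect (exists z, lift_idx z = y); last by rewrite !count_map_notin.
rewrite -zy !count_map_inj // eq_x // ltnNge; apply: contraL yx => xz.
rewrite -zy -leqNgt; move: xz; rewrite leq_eqVlt => /predU1P[->//|/lift_idx_mono].
exact: ltnW.
Qed.

End Lift.

(** * Finite generation of leading monomials *)

Import GRing.Theory.
Local Open Scope ring_scope.
Local Open Scope classical_set_scope.

Section Span.
Variables (K : pzRingType) (V : lmodType K).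

Definition submodule (B : set V) :=
  [/\ B 0, forall x y, B x -> B y -> B (x + y) & forall a x, B x -> B (a *: x)].

Definition span (E : set V) : set V :=
  [set v | forall B, submodule B -> E `<=` B -> B v].

Lemma span_submodule E : submodule (span E).
Proof.
split=> [B [] //|x y xE yE B Bsub EB|a x xE B Bsub EB].
  by have [_ BD _] := Bsub; apply: BD; [apply: xE | apply: yE].
by have [_ _ BZ] := Bsub; apply: BZ; apply: xE.
Qed.

Lemma sub_span E : E `<=` span E.
Proof. by move=> x Ex B _; apply. Qed.

Lemma span_min (E B : set V) : submodule B -> E `<=` B -> span E `<=` B.
Proof. by move=> Bsub EB x; apply. Qed.

Lemma submoduleN B x : submodule B -> B x -> B (- x).
Proof. by move=> [_ _ BZ] Bx; rewrite -scaleN1r; apply: BZ. Qed.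

Lemma submoduleB B x y : submodule B -> B x -> B y -> B (x - y).
Proof. by move=> Bsub Bx By; have [_ BD _] := Bsub; apply: BD => //; apply: submoduleN. Qed.

End Span.

Lemma submodule_preim (K : pzRingType) (V W : lmodType K) (f : {linear W -> V}) (B : set V) :
  submodule B -> submodule (f @^-1` B).
Proof.
move=> [B0 BD BZ]; split=> [|x y Bx By|a x Bx]; rewrite /preimage /=.
- by rewrite linear0.
- by rewrite linearD; apply: BD.
- by rewrite linearZ; apply: BZ.
Qed.

(** * The abstract Groebner basis step: one family of monomials modulo a submodule *)

Section Tier.
Variables (K : fieldType) (V : lmodType K) (Ideal : set (set V)).
Hypothesis Ideal_submodule : forall I, Ideal I -> submodule I.

(** With [Ideal] instantiated by the T_G-ideals, this becomes [TG_generated]. *)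
Definition generated (S : set V) : set V :=
  [set u | forall I, Ideal I -> S `<=` I -> I u].
Hypothesis Ideal_generated : forall S, Ideal (generated S).

Variables (k q : nat) (e : seq nat -> V) (B : set V).
Hypotheses (k_gt0 : (0 < k)%N) (B_sub : submodule B).

Definition profile (m : seq nat) := [seq r <- [seq (x %% k)%N | x <- m] | (r < q)%N].
(* Each role below [q] (such as that of i in [y_i,y_j]) is filled exactly once. *)
Definition valid (m : seq nat) := perm_eq (profile m) (iota 0 q).

Hypothesis e_perm : forall m m', valid m -> perm_eq m m' -> B (e m - e m').
(** The substitute for multiplication of polynomials by monomials: [h] renames variables and [c] is
    the cofactor. The cofactor avoids the roles below [q], since those are already filled. *)
Hypothesis e_op : forall h c, {homo h : i j / (i < j)%N} -> profile c = [::] ->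
  exists f : {linear V -> V}, [/\ forall I, Ideal I -> forall u, I u -> I (f u),
    forall u, B u -> B (f u) &
    forall m, valid m -> B (f (e m) - e (map (lift_idx k h) m ++ c))].

(** Containing [B] makes every later membership a statement modulo [B]. *)
Definition low (P : seq nat -> Prop) : set V :=
  span ([set e m | m in [set m | valid m /\ P m]] `|` B).

Lemma low_submodule P : submodule (low P).
Proof. exact: span_submodule. Qed.

Lemma low_base P : B `<=` low P.
Proof. by move=> x Bx; apply: sub_span; right. Qed.

Lemma low_e (P : seq nat -> Prop) m : valid m -> P m -> low P (e m).
Proof. by move=> mv Pm; apply: sub_span; left; exists m. Qed.

Lemma low_min (P : seq nat -> Prop) (C : set V) : submodule C -> B `<=` C ->
  (forall m, valid m -> P m -> C (e m)) -> low P `<=` C.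
Proof. by move=> C_sub BC Ce; apply: span_min => // u [[m [mv Pm] <-]|/BC//]; apply: Ce. Qed.

Lemma lowD P x y : low P x -> low P y -> low P (x + y).
Proof. by have [_ + _] := low_submodule P; apply. Qed.

Lemma lowZ P a x : low P x -> low P (a *: x).
Proof. by have [_ _ +] := low_submodule P; apply. Qed.

Lemma low_mono (P Q : seq nat -> Prop) : (forall m, P m -> Q m) -> low P `<=` low Q.
Proof.
move=> PQ; apply: span_min; first exact: low_submodule.
by move=> x [[m [mv /PQ Qm] <-]|Bx]; apply: sub_span; [left; exists m | right].
Qed.

(** Bounds the variable indices [x %/ k] by [N], which makes [mlt] well founded. *)
Definition box N (m : seq nat) : Prop := all (ltn^~ (N * k)%N) m.
Lemma box_mono N N' m : (N <= N')%N -> box N m -> box N' m.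
Proof.
move=> NN'; apply: sub_all => x /= xN; apply: leq_trans xN _.
by rewrite leq_mul2r NN' orbT.
Qed.

Lemma box_ex m : exists N, box N m.
Proof.
elim: m => [|x m [N mN]]; first by exists 0%N.
exists (maxn x.+1 N); rewrite /box /=; apply/andP; split; last first.
  by apply: box_mono mN; apply: leq_maxr.
by apply: leq_trans (leq_maxl _ _) _; apply: leq_pmulr.
Qed.

Definition below N m m' := box N m' /\ mlt m' m.

(** Since the vectors [e m] may be dependent, an element has no well-defined leading monomial; only
    the existence of a representation with top term [e m] is asked for. *)
Definition lead (I : set V) N m :=
  [/\ valid m, box N m & exists2 f, I f & low (below N m) (f - e m)].

(** The letter at position [n] is the exponent vector of variable [n], indexed by its roles. *)
Definition wd N (m : seq nat) : seq (nat -> nat) :=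
  mkseq (fun n r => count_mem (n * k + r)%N m) N.

Definition letter_le (a b : nat -> nat) := forall r, (r < k)%N -> (a r <= b r)%N.

Lemma profile_cat m1 m2 : profile (m1 ++ m2) = profile m1 ++ profile m2.
Proof. by rewrite /profile map_cat filter_cat. Qed.

Lemma profile_lift h m : profile (map (lift_idx k h) m) = profile m.
Proof.
by rewrite /profile -map_comp; congr filter; apply: eq_map => x /=; rewrite lift_idx_mod.
Qed.

(** The positions chosen by the embedding rename the variables. The letterwise inequality makes the
    renamed [m] a submultiset of [m'], with complement [c]. *)
Lemma emb_quotient N m N' m' : box N m -> box N' m' ->
  emb (fun=> 0%N) letter_le (wd N m) (wd N' m') ->
  exists h c, [/\ {homo h : i j / (i < j)%N},
    forall x, (x < N * k)%N -> (lift_idx k h x < N' * k)%N &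
    perm_eq m' (map (lift_idx k h) m ++ c)].
Proof.
move=> mN mN' [h h_mono]; rewrite !size_mkseq => hP.
have count_le y : (count_mem y (map (lift_idx k h) m) <= count_mem y m')%N.
  have [/mapP[x xm ->]|/count_memPn->//] := boolP (y \in map (lift_idx k h) m).
  rewrite count_map_inj; last exact: lift_idx_inj.
  have xN : (x %/ k < N)%N by rewrite ltn_divLR //; apply: (allP mN).
  have [hN'] := hP _ xN; rewrite !nth_mkseq //= => /(_ (x %% k)%N (ltn_pmod _ k_gt0)).
  by rewrite -divn_eq.
have [s sm mapE] := (count_subseqP _ _).1 count_le.
have [c mc] := perm_to_subseq sm.
exists h, c; split=> // [x xN|].
  have {}xN : (x %/ k < N)%N by rewrite ltn_divLR.
  by have [hN' _] := hP _ xN; rewrite -ltn_divLR // lift_idx_div.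
by apply: (perm_trans mc); rewrite perm_sym perm_cat2r.
Qed.

(** The operator of [e_op] sends a witness for [m] to one for [m']: it preserves the ideal, and by
    [mlt_op] it keeps the smaller monomials smaller. *)
Lemma lead_transfer (I : set V) N m N' m' : Ideal I -> valid m' -> box N' m' ->
  emb (fun=> 0%N) letter_le (wd N m) (wd N' m') -> lead I N m -> lead I N' m'.
Proof.
move=> I_ideal m'v m'N' memb [mv mN [f If fm]].
have [h [c [h_mono hN m'E]]] := emb_quotient mN m'N' memb.
(* Both [m] and [m'] fill each role below [q] exactly once, so nothing is left for [c]. *)
have c_free : profile c = [::].
  have := perm_size m'v; have := perm_size mv.
  rewrite (perm_size (perm_filter _ (perm_map _ m'E))) -/(profile _).
  rewrite profile_cat profile_lift size_cat => -> /eqP.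
  by rewrite -{2}[size _]addn0 eqn_add2l => /nilP.
have [phi [phiI phiB phi_e]] := e_op h_mono c_free.
have op_valid m1 : valid m1 -> valid (map (lift_idx k h) m1 ++ c).
  by rewrite /valid profile_cat profile_lift c_free cats0.
split=> //; exists (phi f); first exact: phiI.
have -> : phi f - e m' = phi (f - e m) + (phi (e m) - e (map (lift_idx k h) m ++ c))
    + (e (map (lift_idx k h) m ++ c) - e m').
  by rewrite linearB /= !addrA subrK subrK.
apply: lowD; last first.
  by apply: low_base; apply: e_perm; [apply: op_valid | rewrite perm_sym].
apply: lowD; last by apply: low_base; apply: phi_e.
move: fm; apply: (@span_min _ _ _ (phi @^-1` low (below N' m'))).
  exact/submodule_preim/low_submodule.
move=> x [[m1 [m1v [m1N m1m]] <-]|Bx]; last by apply: low_base; apply: phiB.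
rewrite /preimage /= -[phi _](subrK (e (map (lift_idx k h) m1 ++ c))).
apply: lowD; first by apply: low_base; apply: phi_e.
apply: sub_span; left; exists (map (lift_idx k h) m1 ++ c) => //.
split; first exact: op_valid.
split; last by apply: (mlt_perm (m1 := map (lift_idx k h) m ++ c));
  [rewrite perm_sym | apply: mlt_op].
rewrite /box all_cat; apply/andP; split.
  by apply/allP => _ /mapP[y ym1 ->]; apply/hN/(allP m1N).
move: m'N'; rewrite /box (perm_all _ m'E) all_cat; by case/andP.
Qed.

(** The coefficient [c] may be zero, so it is never necessary to decide whether top terms cancel. *)
Lemma low_top (P : seq nat -> Prop) N f : (forall m, P m -> box N m) -> low P f ->
  B f \/ exists m c, [/\ valid m, P m & low (below N m) (f - c *: e m)].
Proof.
move=> PN; pose top f := B f \/ exists m c, [/\ valid m, P m & low (below N m) (f - c *: e m)].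
move: f; apply: (@span_min _ _ _ (top : set V)); last first.
  move=> x [[m [mv Pm] <-]|Bx]; [right | by left].
  exists m, 1; split=> //; rewrite scale1r subrr.
  by have [] := low_submodule (below N m).
have [B0 BD BZ] := B_sub.
split; first by left.
- move=> x y; case=> [Bx|[m [c [mv Pm xm]]]]; case=> [By|[m' [c' [mv' Pm' ym']]]].
  + by left; apply: BD.
  + right; exists m', c'; split=> //; rewrite -addrA.
    by apply: lowD => //; apply: low_base.
  + right; exists m, c; split=> //; rewrite addrAC.
    by apply: lowD => //; apply: low_base.
  + have lowDr m1 m2 u v c1 c2 : valid m1 -> P m1 -> mlt m1 m2 ->
       low (below N m1) (u - c1 *: e m1) -> low (below N m2) (v - c2 *: e m2) ->
       low (below N m2) (u + v - c2 *: e m2).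
      move=> m1v Pm1 m12 um1 vm2.
      rewrite -addrA; apply: lowD => //; rewrite -[u](subrK (c1 *: e m1)).
      apply: lowD; last first.
        by apply: lowZ; apply: sub_span; left; exists m1 => //; do !split => //; apply: PN.
      apply: low_mono um1 => m3 [m3N m31]; split=> //; exact: mlt_trans m12.
    have [mm'|m'm|mm'] := mlt_total m m'; right.
    * by exists m', c'; split=> //; apply: (lowDr m m' x y c c').
    * by exists m, c; split=> //; rewrite addrC [x + y]addrC addrC; apply: (lowDr m' m y x c' c).
    (* Equivalent monomials give the same vector modulo [B], so the coefficients add. *)
    * exists m, (c + c'); split=> //.
      have -> : x + y - (c + c') *: e m =
        (x - c *: e m) + ((y - c' *: e m') + (- c') *: (e m - e m')).
        rewrite scalerDl opprD addrACA; congr (_ + _).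
        by rewrite scalerBr !scaleNr opprK [- _ + _]addrC addrA subrK.
      apply: lowD => //; apply: lowD; last by apply: lowZ; apply: low_base; apply: e_perm.
      apply: low_mono ym' => m3 [m3N m3m]; split=> //.
      by apply: mlt_perm m3m; rewrite perm_sym.
- move=> a x; case=> [Bx|[m [c [mv Pm xm]]]]; [by left; apply: BZ | right].
  exists m, (a * c); split=> //; rewrite -scalerA -scalerBr.
  by apply: lowZ.
Qed.

(* Gaussian reduction by leading monomials, which terminates because [mlt] is
   well founded on the monomials in a box. *)
Lemma lead_reduce (I J : set V) N : submodule J -> Ideal I -> I `<=` J ->
  (forall m, lead J N m -> lead I N m) ->
  forall f, J f -> low (box N) f -> exists2 s, I s & B (f - s).
Proof.
move=> J_sub I_ideal IJ leadJI.
have I_sub := Ideal_submodule I_ideal.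
have [B0 BD BZ] := B_sub; have [I0 ID IZ] := I_sub; have [J0 JD JZ] := J_sub.
(* One reduction, used with [P] equal to [below N m] inside the induction and to [box N] at the
   end. *)
have step (P : seq nat -> Prop) f : (forall m, P m -> box N m) -> J f -> low P f ->
   (forall m g, P m -> J g -> low (below N m) g -> exists2 s, I s & B (g - s)) ->
   exists2 s, I s & B (f - s).
  move=> PN Jf /(low_top PN)[Bf|[m [c [mv Pm fm]]]] IH.
    by exists 0; rewrite ?subr0.
  (* If the coefficient vanishes, [f] already lies below [m]. *)
  have [c0|c0] := eqVneq c 0.
    by apply: IH Pm Jf _; move: fm; rewrite c0 scale0r subr0.
  have leadJm : lead J N m.
    split=> //; first exact: PN.
    exists (c^-1 *: f); first exact: JZ.
    by have := lowZ c^-1 fm; rewrite scalerBr scalerA mulVf // scale1r.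
  have [_ _ [s Is sm]] := leadJI m leadJm.
  have [||t It ftB] := IH m (f - c *: s) Pm.
  - by apply: submoduleB => //; apply: JZ; apply: IJ.
  - have -> : f - c *: s = (f - c *: e m) - c *: (s - e m).
      by rewrite scalerBr opprB addrA subrK.
    by apply: (submoduleB (low_submodule _)) => //; apply: lowZ.
  - exists (c *: s + t); first by apply: ID => //; apply: IZ.
    by rewrite opprD addrA.
have IHm m : box N m -> forall g, J g -> low (below N m) g -> exists2 s, I s & B (g - s).
  move: m; apply: mlt_ind => m mN IHm g Jg /step; apply=> //; first by move=> m' [].
  by move=> m' g' [m'N m'm]; apply: IHm.
by move=> f Jf /step; apply=> // m g mN; apply: IHm.
Qed.

(** Pairs of a box and a leading monomial of [J] have a finite basis for embedding of words. One
    witness per basis pair goes into [S]; by [lead_transfer] the ideal generated by [S] has all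
    leading monomials of [J], and [lead_reduce] applies. *)
Lemma finite_reduction (J : set V) : Ideal J ->
  exists S : set V, [/\ finite_set S, S `<=` J &
    forall f, J f -> low (fun=> True) f -> exists2 s, generated S s & B (f - s)].
Proof.
move=> J_ideal.
pose le (a b : nat * seq nat) :=
  emb (fun=> 0%N) letter_le (wd a.1 a.2) (wd b.1 b.2).
have le_wqo : wqo le.
  move=> s; apply: (higman (fun=> 0%N) _ (dickson k) (fun n => wd (s n).1 (s n).2)).
  by move=> x y z xy yz r rk; apply: leq_trans (xy r rk) (yz r rk).
have [p [pA pP]] := wqo_finite_basis (fun a => lead J a.1 a.2) le_wqo.
have /choice[F FP] : forall a : nat * seq nat, exists f, lead J a.1 a.2 ->
    J f /\ low (below a.1 a.2) (f - e a.2).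
  move=> a; have [[_ _ [f Jf fa]]|na] := pselect (lead J a.1 a.2); first by exists f.
  by exists 0.
pose S : set V := [set F a | a in [set` p]].
have SJ : S `<=` J.
  by move=> _ [a ap <-]; have [] := FP a (pA _ ap).
exists S; split=> //; first exact/finite_image/finite_seq.
have SgenS : S `<=` generated S by move=> x Sx I _; apply.
have genJ : generated S `<=` J by move=> x; apply.
move=> f Jf lowf.
(* Only finitely many monomials are involved, so one box contains them all. *)
have [N fN] : exists N, low (box N) f.
  move: f {Jf} lowf; apply: (@span_min _ _ _ [set f | exists N, low (box N) f]).
    split=> [|x y [N1 xN1] [N2 yN2]|a x [N xN]].
    - by exists 0%N; have [] := low_submodule (box 0).
    - exists (maxn N1 N2); apply: lowD; [apply: low_mono xN1|apply: low_mono yN2] => m;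
        by apply: box_mono; rewrite ?leq_maxl ?leq_maxr.
    - by exists N; apply: lowZ.
  move=> x [[m [mv _] <-]|Bx]; last by exists 0%N; apply: low_base.
  by have [N mN] := box_ex m; exists N; apply: sub_span; left; exists m.
apply: (lead_reduce (Ideal_submodule J_ideal) (Ideal_generated S) genJ _ Jf fN) => m mJ.
have [[N0 m0] mp mm] := pP (N, m) mJ; have [mv mN _] := mJ.
have [m0v m0N _] := pA _ mp.
apply: lead_transfer mv mN mm _ => //.
split=> //; have [_ lowF] := FP _ (pA _ mp); exists (F (N0, m0)) => //.
by apply: SgenS; exists (N0, m0).
Qed.
End Tier.

(** * Decoding multisets of numbers into variables sorted by role *)

Section Roles.
Variable k : nat.
Hypothesis k_gt0 : (0 < k)%N.

Definition roles (m : seq nat) r := [seq (x %/ k)%N | x <- m & (x %% k)%N == r].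
Definition role m r := head 0%N (roles m r).
Definition enc r (s : seq nat) := [seq (x * k + r)%N | x <- s].

Lemma roles_cat m1 m2 r : roles (m1 ++ m2) r = roles m1 r ++ roles m2 r.
Proof. by rewrite /roles filter_cat map_cat. Qed.

Lemma roles_enc r s r' : (r < k)%N -> roles (enc r s) r' = if r == r' then s else [::].
Proof.
move=> rk; rewrite /roles /enc filter_map -map_comp.
have eq_r : {in s, preim (fun x => (x * k + r)%N) (fun x => (x %% k)%N == r') =1
    fun=> r == r'}.
  by move=> x _ /=; rewrite modnMDl modn_small.
rewrite (eq_in_filter eq_r); case: (r == r'); last by rewrite filter_pred0.
rewrite filter_predT -[RHS]map_id; apply/eq_map => x /=.
by rewrite divnMDl // divn_small // addn0.
Qed.

Lemma profile_enc q r s : (r < k)%N ->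
  profile k q (enc r s) = if (r < q)%N then nseq (size s) r else [::].
Proof.
move=> rk; elim: s => [|x s IHs]; first by case: ifP.
rewrite /profile /= modnMDl modn_small //; move: IHs; rewrite /profile => ->.
by case: (r < q)%N.
Qed.

Lemma roles_perm m m' r : perm_eq m m' -> perm_eq (roles m r) (roles m' r).
Proof. by move=> mm'; apply/perm_map/perm_filter. Qed.

Lemma roles_lift h m c r :
  roles (map (lift_idx k h) m ++ c) r = map h (roles m r) ++ roles c r.
Proof.
rewrite roles_cat; congr (_ ++ _); rewrite /roles filter_map -!map_comp.
rewrite (eq_filter (a2 := fun x => (x %% k)%N == r)); last first.
  by move=> x /=; rewrite lift_idx_mod.
by apply: eq_map => x /=; rewrite lift_idx_div.
Qed.

Lemma size_roles q m r : (r < q)%N -> size (roles m r) = count_mem r (profile k q m).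
Proof.
move=> rq; rewrite size_map size_filter /profile count_filter count_map.
by apply: eq_count => x /=; case: eqP => // ->; rewrite rq.
Qed.

Lemma size_roles_valid q m r : (r < q)%N -> valid k q m -> size (roles m r) = 1%N.
Proof.
move=> rq mv; rewrite (size_roles m rq) (permP mv).
by rewrite count_uniq_mem ?iota_uniq // mem_iota rq.
Qed.

Lemma role_perm q m m' r : (r < q)%N -> valid k q m -> perm_eq m m' -> role m r = role m' r.
Proof.
move=> rq mv mm'; rewrite /role; congr head; apply/esym/perm_small_eq.
  by rewrite (size_roles_valid rq mv).
by rewrite perm_sym; apply: roles_perm.
Qed.

Lemma role_lift q h m c r : (r < q)%N -> valid k q m -> profile k q c = [::] ->
  role (map (lift_idx k h) m ++ c) r = h (role m r).
Proof.
move=> rq mv _; rewrite /role roles_lift; have := size_roles_valid rq mv.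
by case: (roles m r).
Qed.

End Roles.

(** * Brackets in UT_3 *)

Section LieLemmas.
Variables (K : pzRingType) (L : lieAlgType K).
Implicit Types u v w : L.

Lemma lie0l v : lie 0 v = 0.
Proof. by have := lieZl 0 0 v; rewrite !scale0r. Qed.

Lemma lie0r v : lie v 0 = 0.
Proof. by have := lieZr 0 v 0; rewrite !scale0r. Qed.

Lemma lieC u v : lie u v = - lie v u.
Proof.
apply/eqP; rewrite -addr_eq0; have := liexx (u + v).
by rewrite lieDl !lieDr !liexx add0r addr0 => ->.
Qed.

Lemma lieNl u v : lie (- u) v = - lie u v.
Proof. by rewrite -scaleN1r lieZl scaleN1r. Qed.

Lemma lieNr u v : lie u (- v) = - lie u v.
Proof. by rewrite lieC lieNl -lieC. Qed.

Lemma lieBl u v w : lie (u - v) w = lie u w - lie v w.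
Proof. by rewrite lieDl lieNl. Qed.

(** The Jacobi identity in the form that produces left-normed brackets. *)
Lemma lie_lier u v w : lie u (lie v w) = lie (lie u v) w - lie (lie u w) v.
Proof.
have := lie_jacobi u v w; rewrite (lieC v (lie w u)) (lieC w (lie u v)) (lieC w u) lieNl opprK.
by move=> /eqP; rewrite subr_eq0 => /eqP <-; rewrite addrK.
Qed.

Lemma submodule_lie (B : set L) v : submodule B -> submodule [set u | B (lie u v)].
Proof.
move=> [B0 BD BZ]; split=> [|x y Bx By|a x Bx] /=; first by rewrite lie0l.
  by rewrite lieDl; apply: BD.
by rewrite lieZl; apply: BZ.
Qed.

End LieLemmas.

Section UT3.
Variable K : comNzRingType.
Implicit Types A B : UT K 3.

Definition i0 : 'I_3 := @Ordinal 3 0 isT.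
Definition i1 : 'I_3 := @Ordinal 3 1 isT.
Definition i2 : 'I_3 := @Ordinal 3 2 isT.

Lemma ord3P (P : 'I_3 -> Prop) : P i0 -> P i1 -> P i2 -> forall i, P i.
Proof.
move=> P0 P1 P2 [[|[|[|//]]] i3].
- by rewrite (_ : Ordinal i3 = i0) //; apply: val_inj.
- by rewrite (_ : Ordinal i3 = i1) //; apply: val_inj.
- by rewrite (_ : Ordinal i3 = i2) //; apply: val_inj.
Qed.

Lemma ut_lower A (i j : 'I_3) : (j < i)%N -> A i j = 0.
Proof. exact/upper_trigP/ut_mxP. Qed.

Lemma ut_lieE A B i j : lie A B i j =
  A i i0 * B i0 j + A i i1 * B i1 j + A i i2 * B i2 j
  - (B i i0 * A i0 j + B i i1 * A i1 j + B i i2 * A i2 j).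
Proof.
have sum3 (F : 'I_3 -> K) : \sum_k F k = F i0 + F i1 + F i2.
  rewrite !big_ord_recl big_ord0 addr0 addrA.
  by congr (F _ + F _ + F _); apply: val_inj.
by rewrite /lie /= !mxE !sum3.
Qed.

(** The subspaces are: [utY] the diagonal plus e_23, [utZ] the span of e_12 and e_13, [utN] the line
    of e_23, and [utC] the line of e_13. *)
Definition utY A := A i0 i1 = 0 /\ A i0 i2 = 0.
Definition utZ A := [/\ A i0 i0 = 0, A i1 i1 = 0, A i2 i2 = 0 & A i1 i2 = 0].
Definition utN A := utY A /\ [/\ A i0 i0 = 0, A i1 i1 = 0 & A i2 i2 = 0].
Definition utC A := utZ A /\ A i0 i1 = 0.

Lemma ut_eq0 A : utY A -> utZ A -> A = 0.
Proof.
move=> [A01 A02] [A00 A11 A22 A12]; apply/val_inj/matrixP => i j; rewrite /= mxE.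
by elim/ord3P: i; elim/ord3P: j; rewrite ?A00 ?A01 ?A02 ?A11 ?A12 ?A22 // ut_lower.
Qed.

Lemma ut_lieYY A B : utY A -> utY B -> utN (lie A B).
Proof.
move=> [A01 A02] [B01 B02].
do 2?split; rewrite ut_lieE ?(@ut_lower A i1 i0) ?(@ut_lower A i2 i0)
  ?(@ut_lower A i2 i1) ?(@ut_lower B i1 i0) ?(@ut_lower B i2 i0) ?(@ut_lower B i2 i1) ?A01 ?A02 ?B01 ?B02 //; ring.
Qed.

Lemma ut_lieZY A B : utZ A -> utY B -> utZ (lie A B).
Proof.
move=> [A00 A11 A22 A12] [B01 B02].
split; rewrite ut_lieE ?(@ut_lower A i1 i0) ?(@ut_lower A i2 i0)
  ?(@ut_lower A i2 i1) ?(@ut_lower B i1 i0) ?(@ut_lower B i2 i0) ?(@ut_lower B i2 i1)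
  ?A00 ?A11 ?A22 ?A12 ?B01 ?B02 //; ring.
Qed.

Lemma ut_lieZN A B : utZ A -> utN B -> utC (lie A B).
Proof.
move=> ZA [YB [B00 B11 B22]]; split; first exact: ut_lieZY.
move: ZA YB => [A00 A11 A22 A12] [B01 B02].
rewrite ut_lieE (@ut_lower A i2 i1) // (@ut_lower B i2 i1) // A00 A11 B00 B11 B01.
ring.
Qed.

Lemma ut_lieCY A B : utC A -> utY B -> utC (lie A B).
Proof.
move=> [ZA A01] YB; split; first exact: ut_lieZY.
move: ZA YB => [A00 A11 A22 A12] [B01 B02].
by rewrite ut_lieE (@ut_lower A i2 i1) // (@ut_lower B i2 i1) // A00 A11 A01 B01; ring.
Qed.

Lemma ut_lieCN A B : utC A -> utN B -> lie A B = 0.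
Proof.
move=> CA NB; have [ZC C01] := ut_lieCY CA NB.1.
apply: ut_eq0 => //; split=> //; move: CA NB => [[A00 A11 A22 A12] A01] [[B01 B02] [B00 B11 B22]].
by rewrite ut_lieE A00 A01 B00 B01 B02 A22 B22; ring.
Qed.

Lemma ut_lieNN A B : utN A -> utN B -> lie A B = 0.
Proof.
move=> NA NB; have [Y0 [? ? ?]] := ut_lieYY NA.1 NB.1; apply: ut_eq0 => //; split=> //.
move: NA NB => [[A01 A02] [A00 A11 A22]] [[B01 B02] [B00 B11 B22]].
by rewrite ut_lieE (@ut_lower A i1 i0) // (@ut_lower B i1 i0) // A11 A22 B11 B22; ring.
Qed.

Lemma ut_lieZZ A B : utZ A -> utZ B -> lie A B = 0.
Proof.
move=> [A00 A11 A22 A12] [B00 B11 B22 B12].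
apply: ut_eq0; [split | split]; rewrite ut_lieE ?(@ut_lower A i1 i0) ?(@ut_lower A i2 i0)
  ?(@ut_lower A i2 i1) ?(@ut_lower B i1 i0) ?(@ut_lower B i2 i0) ?(@ut_lower B i2 i1)
  ?A00 ?A11 ?A22 ?A12 ?B00 ?B11 ?B22 ?B12 //; ring.
Qed.

Lemma Gamma1_utY (G : groupType) (g : G) A : g <> 1%g -> Gamma g 1%g 1%g A -> utY A.
Proof.
move=> g1 GA; split; apply/eqP; apply: contra_notT g1.
  by move=> /(GA i0 i1 isT).
by move=> /(GA i0 i2 isT); rewrite /ut3_deg /= mulg1.
Qed.

Lemma Gammag_utZ (G : groupType) (g : G) A : g <> 1%g -> Gamma g 1%g g A -> utZ A.
Proof.
by move=> g1 GA; split; apply/eqP; apply: contra_notT g1 => /GA <-.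
Qed.

Lemma Gamma_other (G : groupType) (g k : G) A : k <> 1%g -> k <> g -> Gamma g 1%g k A -> A = 0.
Proof.
move=> k1 kg GA; apply: ut_eq0; split; apply/eqP.
- by apply: contra_notT kg => /GA <-.
- by apply: contra_notT kg => /GA <- //; rewrite /ut3_deg /= mulg1.
- by apply: contra_notT k1 => /GA <-.
- by apply: contra_notT k1 => /GA <-.
- by apply: contra_notT k1 => /GA <-.
- by apply: contra_notT k1 => /GA <-.
Qed.

End UT3.

(** * Monomials in the free graded Lie algebra *)

Section FreeGraded.
Variables (K : fieldType) (G : groupType) (g : G).
Hypothesis g_neq1 : g <> 1%g.

Local Notation L := (freeGLie K G).
Local Notation homog := (@fl_homog K G).
Local Notation y i := (gvar K i (1%g : G)).
Local Notation z i := (gvar K i g).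
Local Notation Id := (graded_identities homog (@Gamma K G g 1%g)).

Lemma TG_submodule (J : set L) : TG_ideal homog J -> submodule J.
Proof. by case=> -[J0 JD JZ _] _. Qed.

Lemma TG_lier (J : set L) u v : TG_ideal homog J -> J u -> J (lie u v).
Proof.
move=> J_ideal Ju; have [[_ _ _ J_lie] _] := J_ideal.
by rewrite lieC; apply: (submoduleN (TG_submodule J_ideal)); apply: J_lie.
Qed.

Lemma TG_generated_ideal (S : set L) : TG_ideal homog (TG_generated homog S).
Proof.
split; first split=> [J [[]]//|u v Su Sv J Jid SJ|a u Su J Jid SJ|u v Sv J Jid SJ].
- by have [[_ JD _ _] _] := Jid; apply: JD; [apply: Su | apply: Sv].
- by have [[_ _ JZ _] _] := Jid; apply: JZ; apply: Su.
- by have [[_ _ _ Jl] _] := Jid; apply: Jl; apply: Sv.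
- move=> f f_hom u Su J Jid SJ; have [_ Jf] := Jid.
  by apply: Jf => //; apply: Su.
Qed.

Lemma Id_ideal : TG_ideal homog Id.
Proof.
split; first split=> [f _|u v Iu Iv f fh|a u Iu f fh|u v Iv f fh].
- by rewrite linear0.
- by rewrite linearD Iu // Iv // addr0.
- by rewrite linearZ /= Iu // scaler0.
- by have [fl _] := fh; rewrite fl Iv // lie0r.
move=> f [f_lie f_hom] u Iu p [p_lie p_hom].
apply: (Iu (p \o f)); split=> [v w|k v vk] /=; first by rewrite f_lie p_lie.
by apply/p_hom/f_hom.
Qed.

(** For [P] equal to [eq^~ 0] this is membership in [Id], which is how brackets vanishing in UT_3
    become identities. *)
Definition holds (P : UT K 3 -> Prop) (u : L) :=
  forall f : {linear L -> UT K 3}, graded_hom homog (@Gamma K G g 1%g) f -> P (f u).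

Lemma holds_lie (P Q R : UT K 3 -> Prop) u v :
  (forall A B, P A -> Q B -> R (lie A B)) -> holds P u -> holds Q v -> holds R (lie u v).
Proof. by move=> PQR Pu Qv f fh; rewrite (fh.1); apply: PQR; [apply: Pu | apply: Qv]. Qed.

Lemma holds_y i : holds (@utY K) (y i).
Proof. by move=> f [_ fh]; apply: (Gamma1_utY g_neq1); apply/fh/fl_homog_var. Qed.

Lemma holds_z i : holds (@utZ K) (z i).
Proof. by move=> f [_ fh]; apply: (Gammag_utZ g_neq1); apply/fh/fl_homog_var. Qed.

Lemma Id_var i k : k <> 1%g -> k <> g -> Id (gvar K i k).
Proof. by move=> k1 kg f [_ fh]; apply: (Gamma_other k1 kg); apply/fh/fl_homog_var. Qed.

Fixpoint rmul (s : seq nat) (u : L) : L :=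
  if s is i :: s' then rmul s' (lie u (y i)) else u.

Lemma rmul_linear s : linear (rmul s).
Proof. by elim: s => //= i s IHs a u v; rewrite lieDl lieZl IHs. Qed.
HB.instance Definition _ s := GRing.isLinear.Build K L L _ (rmul s) (rmul_linear s).

Lemma rmul_cat s t u : rmul (s ++ t) u = rmul t (rmul s u).
Proof. by elim: s u => /=. Qed.

Lemma rmul_rcons s i u : rmul (rcons s i) u = lie (rmul s u) (y i).
Proof. by rewrite -cats1 rmul_cat. Qed.

Lemma rmul_ideal (J : set L) s u : TG_ideal homog J -> J u -> J (rmul s u).
Proof. by move=> J_ideal; elim: s u => //= i s IHs u Ju; apply: IHs; apply: TG_lier. Qed.

Lemma rmul_holds (P : UT K 3 -> Prop) s u :
  (forall A B, P A -> utY B -> P (lie A B)) -> holds P u -> holds P (rmul s u).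
Proof.
move=> Pl; elim: s u => //= i s IHs u Pu; apply: IHs.
by apply: (holds_lie Pl) => //; apply: holds_y.
Qed.

Lemma rmul_homog s k u : homog k u -> homog k (rmul s u).
Proof.
elim: s u => //= i s IHs u uk; apply: IHs.
by rewrite -(mulg1 k); apply: fl_homog_lie => //; apply: fl_homog_var.
Qed.

(* Swapping two adjacent letters costs one commutator. *)
Lemma rmul_perm (B : set L) u s s' : submodule B ->
  (forall s1 i j s2, B (rmul s2 (lie (rmul s1 u) (lie (y i) (y j))))) ->
  perm_eq s s' -> B (rmul s u - rmul s' u).
Proof.
move=> B_sub; have [B0 BD _] := B_sub.
have move_front i s1 s2 w :
    (forall s1 i j s2, B (rmul s2 (lie (rmul s1 w) (lie (y i) (y j))))) ->
    B (rmul (i :: s1 ++ s2) w - rmul (s1 ++ i :: s2) w).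
  elim: s1 w => [|a s1 IHs] w Bw /=; first by rewrite subrr.
  rewrite -[X in X - _](subrK (rmul (i :: s1 ++ s2) (lie w (y a)))) -addrA.
  apply: BD; last by apply: IHs => s3; apply: (Bw (a :: s3)).
  rewrite /= -linearB -lie_lier; exact: (Bw [::]).
elim: s u s' => [|i s IHs] u s' Bu ss'.
  by move: ss'; rewrite perm_sym => /perm_nilP ->; rewrite subrr.
have is' : i \in s' by rewrite -(perm_mem ss') mem_head.
case/splitPr: is' ss' => s1 s2; rewrite perm_sym perm_catC /= perm_cons perm_catC => ss'.
rewrite -[X in X - _](subrK (rmul (i :: s1 ++ s2) u)) -addrA.
apply: BD; last exact: move_front.
by apply: IHs; [move=> s3; apply: (Bu (i :: s3)) | rewrite perm_sym].
Qed.

(** * Graded endomorphisms that rename variables and multiply the z's by y's *)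

Section Subst.
Variables (h : nat -> nat) (a : seq nat).

(** The y's have degree 1, so bracketing with them preserves degrees. This inserts y's next to z,
    inside a monomial, where bracketing from outside cannot reach. *)
Definition subst_var (x : nat * G) : L :=
  if `[< x.2 = g >] then rmul a (gvar K (h x.1) x.2) else gvar K (h x.1) x.2.

Definition subst : L -> L := fl_lift subst_var.
HB.instance Definition _ := GRing.Linear.on subst.

Lemma subst_gvar i k : subst (gvar K i k) = subst_var (i, k).
Proof. exact: fl_lift_var. Qed.

Lemma subst_lie u v : subst (lie u v) = lie (subst u) (subst v).
Proof. exact: fl_lift_lie. Qed.

Lemma subst_hom : graded_hom homog homog subst.
Proof.
split; first exact: fl_lift_lie.
move=> k u; elim=> {k u} [i k|k|k u v _ uk _ vk|k c u _ uk|k l u v _ uk _ vl].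
- rewrite [X in homog k X]subst_gvar /subst_var /=.
  by case: asboolP => _; [apply: rmul_homog|]; apply: fl_homog_var.
- by rewrite linear0; apply: fl_homog0.
- by rewrite linearD; apply: fl_homogD.
- by rewrite linearZ; apply: fl_homogZ.
- by rewrite [X in homog _ X]subst_lie; apply: fl_homog_lie.
Qed.

Lemma subst_ideal (J : set L) u : TG_ideal homog J -> J u -> J (subst u).
Proof. by move=> [_ Jf] Ju; apply: Jf => //; apply: subst_hom. Qed.

Lemma subst_y i : subst (y i) = y (h i).
Proof.
by rewrite subst_gvar /subst_var /=; case: asboolP => // /esym/g_neq1.
Qed.

Lemma subst_z i : subst (z i) = rmul a (z (h i)).
Proof. by rewrite subst_gvar /subst_var /=; case: asboolP. Qed.

Lemma subst_rmul s u : subst (rmul s u) = rmul (map h s) (subst u).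
Proof. by elim: s u => //= i s IHs u; rewrite IHs subst_lie subst_y. Qed.

End Subst.

(** * The four families of monomials and their spans *)

Definition mon1 i j b := rmul b (lie (y i) (y j)).
Definition mon2 i := y i.
Definition mon3 l a i j b := rmul b (lie (rmul a (z l)) (lie (y i) (y j))).
Definition mon4 l a := rmul a (z l).

Lemma comm_utN i j : holds (@utN K) (lie (y i) (y j)).
Proof. by apply: (holds_lie (@ut_lieYY K)); apply: holds_y. Qed.

Lemma mon1_utN i j b : holds (@utN K) (mon1 i j b).
Proof.
apply: rmul_holds (comm_utN i j) => A B NA YB.
by apply: ut_lieYY YB; case: NA.
Qed.

Lemma mon4_utZ l a : holds (@utZ K) (mon4 l a).
Proof. by apply: rmul_holds (holds_z l); apply: ut_lieZY. Qed.

Lemma mon3_utC l a i j b : holds (@utC K) (mon3 l a i j b).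
Proof.
apply: rmul_holds; first exact: ut_lieCY.
by apply: (holds_lie (@ut_lieZN K)); [apply: mon4_utZ | apply: comm_utN].
Qed.

Lemma Id_submodule : submodule Id.
Proof. exact/TG_submodule/Id_ideal. Qed.

(** A swap in [b] costs a bracket of two elements with values in the line of e_23, which
    vanishes. *)
Lemma mon1_perm i j b b' : perm_eq b b' -> Id (mon1 i j b - mon1 i j b').
Proof.
apply: (rmul_perm (B := Id)) => [|s1 k l s2]; first exact: Id_submodule.
apply: (rmul_ideal _ Id_ideal).
exact: (holds_lie (R := eq^~ 0) (@ut_lieNN K) (mon1_utN i j s1) (comm_utN k l)).
Qed.

(** A swap in [a] changes the inner factor by an element with values in the line of e_13, which
    brackets to zero with [[y_i,y_j]]. A swap in [b] vanishes for the same reason. *)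
Lemma mon3_perm l a a' i j b b' : perm_eq a a' -> perm_eq b b' ->
  Id (mon3 l a i j b - mon3 l a' i j b').
Proof.
move=> aa' bb'; have [_ IdD _] := Id_submodule.
rewrite -[X in X - _](subrK (mon3 l a' i j b)) -addrA; apply: IdD.
  rewrite /mon3 -linearB -lieBl; apply: (rmul_ideal _ Id_ideal).
  apply: (holds_lie (R := eq^~ 0) (@ut_lieCN K) _ (comm_utN i j)).
  apply: (rmul_perm (B := holds (@utC K))) aa' => [|s1 k m s2]; last exact: mon3_utC.
  split=> [f _|u v Cu Cv f fh|c u Cu f fh].
  - by rewrite linear0; do 2?split; rewrite mxE.
  - have [[u1 u2 u3 u4] u5] := Cu f fh; have [[v1 v2 v3 v4] v5] := Cv f fh.
    by rewrite linearD; do 2?split; rewrite mxE ?u1 ?u2 ?u3 ?u4 ?u5 ?v1 ?v2 ?v3 ?v4 ?v5 addr0.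
  - have [[e1 e2 e3 e4] e5] := Cu f fh.
    by rewrite linearZ /=; do 2?split; rewrite mxE ?e1 ?e2 ?e3 ?e4 ?e5 mulr0.
apply: (rmul_perm (B := Id)) bb' => [|s1 k m s2]; first exact: Id_submodule.
apply: (rmul_ideal _ Id_ideal).
exact: (holds_lie (R := eq^~ 0) (@ut_lieCN K) (mon3_utC l a' i j s1) (comm_utN k m)).
Qed.

(** Decoding by role: 0, 1 are i, j and 2 is [b] in [e1]; 0, 1, 2 are l, i, j and 3, 4 are [a], [b]
    in [e3]; 0 is l and 1 is [a] in [e4]. The variables y and z of one index share a letter of [wd],
    hence are renamed together. *)
Definition e1 m := mon1 (role 3 m 0) (role 3 m 1) (roles 3 m 2).
Definition e2 m := mon2 (role 1 m 0).
Definition e3 m :=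
  mon3 (role 5 m 0) (roles 5 m 3) (role 5 m 1) (role 5 m 2) (roles 5 m 4).
Definition e4 m := mon4 (role 2 m 0) (roles 2 m 1).

(** An ascending chain from [Id] to the whole algebra; each family is treated modulo the previous
    member. *)
Definition D1 : set L := low 3 2 e1 Id (fun=> True).
Definition D2 : set L := low 1 1 e2 D1 (fun=> True).
Definition D3 : set L := low 5 3 e3 D2 (fun=> True).
Definition D4 : set L := low 2 1 e4 D3 (fun=> True).

Lemma D1_sub : submodule D1. Proof. exact: low_submodule. Qed.
Lemma D2_sub : submodule D2. Proof. exact: low_submodule. Qed.
Lemma D3_sub : submodule D3. Proof. exact: low_submodule. Qed.
Lemma D4_sub : submodule D4. Proof. exact: low_submodule. Qed.

Lemma Id_D1 : Id `<=` D1. Proof. exact: low_base. Qed.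
Lemma D1_D2 : D1 `<=` D2. Proof. exact: low_base. Qed.
Lemma D2_D3 : D2 `<=` D3. Proof. exact: low_base. Qed.
Lemma D3_D4 : D3 `<=` D4. Proof. exact: low_base. Qed.

Lemma mon1_D1 i j b : D1 (mon1 i j b).
Proof.
pose m := enc 3 0 [:: i] ++ enc 3 1 [:: j] ++ enc 3 2 b.
have -> : mon1 i j b = e1 m by rewrite /e1 /role !roles_cat !roles_enc.
by apply: low_e => //; rewrite /valid !profile_cat !profile_enc.
Qed.

Lemma mon2_D2 i : D2 (mon2 i).
Proof.
pose m := enc 1 0 [:: i].
have -> : mon2 i = e2 m by rewrite /e2 /role !roles_enc.
by apply: low_e => //; rewrite /valid !profile_enc.
Qed.

Lemma mon3_D3 l a i j b : D3 (mon3 l a i j b).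
Proof.
pose m := enc 5 0 [:: l] ++ enc 5 1 [:: i] ++ enc 5 2 [:: j] ++ enc 5 3 a ++ enc 5 4 b.
have -> : mon3 l a i j b = e3 m by rewrite /e3 /role !roles_cat !roles_enc //= cats0.
by apply: low_e => //; rewrite /valid !profile_cat !profile_enc.
Qed.

Lemma mon4_D4 l a : D4 (mon4 l a).
Proof.
pose m := enc 2 0 [:: l] ++ enc 2 1 a.
have -> : mon4 l a = e4 m by rewrite /e4 /role !roles_cat !roles_enc.
by apply: low_e => //; rewrite /valid !profile_cat !profile_enc.
Qed.

(** * Stability of the chain of spans, and its exhaustion of the free algebra *)

Lemma rmul_Id s u : Id u -> Id (rmul s u).
Proof. exact: (rmul_ideal _ Id_ideal). Qed.

Lemma rmul_D1 s u : D1 u -> D1 (rmul s u).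
Proof.
move: u; apply: (low_min (C := rmul s @^-1` D1)).
- exact/submodule_preim/D1_sub.
- by move=> u Iu; apply: Id_D1; apply: rmul_Id.
- by move=> m _ _; rewrite /preimage /= /e1 /mon1 -rmul_cat; apply: mon1_D1.
Qed.

Lemma rmul_D2 s u : D2 u -> D2 (rmul s u).
Proof.
move: u; apply: (low_min (C := rmul s @^-1` D2)).
- exact/submodule_preim/D2_sub.
- by move=> u Du; apply: D1_D2; apply: rmul_D1.
- move=> m _ _; rewrite /preimage /= /e2; case: s => [|i s]; first exact: mon2_D2.
  exact: (D1_D2 (mon1_D1 _ _ s)).
Qed.

Lemma rmul_D3 s u : D3 u -> D3 (rmul s u).
Proof.
move: u; apply: (low_min (C := rmul s @^-1` D3)).
- exact/submodule_preim/D3_sub.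
- by move=> u Du; apply: D2_D3; apply: rmul_D2.
- by move=> m _ _; rewrite /preimage /= /e3 /mon3 -rmul_cat; apply: mon3_D3.
Qed.

Lemma rmul_D4 s u : D4 u -> D4 (rmul s u).
Proof.
move: u; apply: (low_min (C := rmul s @^-1` D4)).
- exact/submodule_preim/D4_sub.
- by move=> u Du; apply: D3_D4; apply: rmul_D3.
- by move=> m _ _; rewrite /preimage /= /e4 /mon4 -rmul_cat; apply: mon4_D4.
Qed.

Lemma subst_Id h a u : Id u -> Id (subst h a u).
Proof. exact: (subst_ideal _ _ Id_ideal). Qed.

Lemma subst_mon1 h a i j b : subst h a (mon1 i j b) = mon1 (h i) (h j) (map h b).
Proof. by rewrite /mon1 subst_rmul subst_lie !subst_y. Qed.

Lemma subst_mon3 h l a i j b c :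
  subst h c (mon3 l a i j b) = mon3 (h l) (c ++ map h a) (h i) (h j) (map h b).
Proof.
by rewrite /mon3 subst_rmul subst_lie subst_lie !subst_y subst_rmul subst_z -rmul_cat.
Qed.

Lemma subst_mon4 h l a c : subst h c (mon4 l a) = mon4 (h l) (c ++ map h a).
Proof. by rewrite /mon4 subst_rmul subst_z -rmul_cat. Qed.

Lemma subst_D1 h a u : D1 u -> D1 (subst h a u).
Proof.
move: u; apply: (low_min (C := subst h a @^-1` D1)).
- exact/submodule_preim/D1_sub.
- by move=> u Iu; apply: Id_D1; apply: subst_Id.
- by move=> m _ _; rewrite /preimage /= /e1 subst_mon1; apply: mon1_D1.
Qed.

Lemma subst_D2 h a u : D2 u -> D2 (subst h a u).
Proof.
move: u; apply: (low_min (C := subst h a @^-1` D2)).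
- exact/submodule_preim/D2_sub.
- by move=> u Iu; apply: D1_D2; apply: subst_D1.
- by move=> m _ _; rewrite /preimage /= /e2 /mon2 subst_y; apply: mon2_D2.
Qed.

Lemma subst_D3 h a u : D3 u -> D3 (subst h a u).
Proof.
move: u; apply: (low_min (C := subst h a @^-1` D3)).
- exact/submodule_preim/D3_sub.
- by move=> u Iu; apply: D2_D3; apply: subst_D2.
- by move=> m _ _; rewrite /preimage /= /e3 subst_mon3; apply: mon3_D3.
Qed.

(** By Jacobi the last y of [b] moves either outside, where [D3] is stable, or onto the z-factor,
    lengthening [a]; hence the induction over all [a]. *)
Lemma lie_mon4_mon1 l a i j b : D3 (lie (mon4 l a) (mon1 i j b)).
Proof.
elim/last_ind: b a => [|b x IHb] a; first exact: (mon3_D3 l a i j [::]).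
rewrite /mon1 rmul_rcons lie_lier; apply: (submoduleB D3_sub).
  by apply: (rmul_D3 [:: x]); apply: IHb.
by rewrite -[lie (mon4 l a) _]/(rmul [:: x] (rmul a (z l))) -rmul_cat; apply: IHb.
Qed.

(** The case of degree g goes down the chain: families 4 and 3 bracket with z to identities, family
    2 gives a monomial of family 4, and family 1 lands in [D3] by [lie_mon4_mon1]. *)
Lemma lie_gvar_D4 i k u : D4 u -> D4 (lie u (gvar K i k)).
Proof.
have IdD4 v : Id v -> D4 v by move=> Iv; apply: D3_D4; apply: D2_D3; apply: D1_D2; apply: Id_D1.
have [->|k1] := pselect (k = 1%g); first exact: (rmul_D4 [:: i]).
have [->|kg] := pselect (k = g); last first.
  move=> _; apply: IdD4; have [[_ _ _ Id_lie] _] := Id_ideal.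
  by apply: Id_lie; apply: Id_var.
have DzSub := submodule_lie (z i) D4_sub.
have zD4 m : D4 (lie (mon1 (role 3 m 0) (role 3 m 1) (roles 3 m 2)) (z i)).
  rewrite lieC; apply: (submoduleN D4_sub); apply: D3_D4.
  exact: (lie_mon4_mon1 i [::]).
have ZZ v : holds (@utZ K) v -> D4 (lie v (z i)).
  move=> Zv; apply: IdD4.
  exact: (holds_lie (R := eq^~ 0) (@ut_lieZZ K) Zv (holds_z i)).
apply: (low_min DzSub); last by move=> m _ _; apply: ZZ; apply: mon4_utZ.
apply: (low_min DzSub); last first.
  by move=> m _ _; apply: ZZ => f fh; have [] := mon3_utC (role 5 m 0) (roles 5 m 3)
    (role 5 m 1) (role 5 m 2) (roles 5 m 4) fh.
apply: (low_min DzSub); last first.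
  move=> m _ _; rewrite /= lieC; apply: (submoduleN D4_sub).
  exact: (mon4_D4 i [:: role 1 m 0]).
apply: (low_min DzSub) => [v Iv|m _ _]; last exact: zD4.
by apply: IdD4; apply: (TG_lier _ Id_ideal).
Qed.

Lemma D4_full u : D4 u.
Proof.
(* Jacobi reduces bracketing by an arbitrary Lie expression to bracketing by generators. *)
have D4_lie s : forall v, D4 v -> D4 (lie v (fl_pi s)).
  have [D40 D4D D4Z] := D4_sub.
  elim: s => [[i k]||s IHs t IHt|s IHs|c s IHs|s IHs t IHt] v Dv.
  - exact: lie_gvar_D4.
  - by rewrite fl_pi0 lie0r.
  - by rewrite fl_piD lieDr; apply: D4D; [apply: IHs | apply: IHt].
  - by rewrite fl_piN lieNr; apply: (submoduleN D4_sub); apply: IHs.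
  - by rewrite fl_piZ lieZr; apply: D4Z; apply: IHs.
  - rewrite fl_pi_lie lie_lier; apply: (submoduleB D4_sub).
      by apply: IHt; apply: IHs.
    by apply: IHs; apply: IHt.
have [D40 D4D D4Z] := D4_sub.
elim/fl_ind: u; elim=> [[i k]||s IHs t IHt|s IHs|c s IHs|s IHs t IHt].
- have [->|k1] := pselect (k = 1%g); first by apply: D3_D4; apply: D2_D3; apply: mon2_D2.
  have [->|kg] := pselect (k = g); first exact: (mon4_D4 i [::]).
  by apply: D3_D4; apply: D2_D3; apply: D1_D2; apply: Id_D1; apply: Id_var.
- by rewrite fl_pi0.
- by rewrite fl_piD; apply: D4D.
- by rewrite fl_piN; apply: (submoduleN D4_sub).
- by rewrite fl_piZ; apply: D4Z.
- by rewrite fl_pi_lie; apply: D4_lie.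
Qed.

(** * Finite generation, family by family *)

Section Tiers.
Variable J : set L.
Hypothesis J_ideal : TG_ideal homog J.

Definition reduces (D D' : set L) := exists S : set L, [/\ finite_set S, S `<=` J &
  forall f, J f -> D f -> exists2 s, TG_generated homog S s & D' (f - s)].

Lemma tier1 : reduces D1 Id.
Proof.
apply: (finite_reduction TG_submodule TG_generated_ideal) => //.
- exact: Id_submodule.
- move=> m m' mv mm'; rewrite /e1 -!(role_perm _ mv mm') //.
  by apply: mon1_perm; apply: roles_perm.
- move=> h c h_mono c0.
  (* The entries of [c] all have role 2, so they are bracketed on at the right after renaming. *)
  exists (rmul (roles 3 c 2) \o subst h [::]); split=> [I Iid u Iu|u Iu|m mv] /=.
  + by apply: (rmul_ideal _ Iid); apply: (subst_ideal _ _ Iid).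
  + by apply: rmul_Id; apply: subst_Id.
  + rewrite /e1 subst_mon1 /mon1 -rmul_cat !(role_lift _ _ _ mv) // roles_lift // subrr.
    by have [] := Id_submodule.
Qed.

Lemma tier2 : reduces D2 D1.
Proof.
have [D10 _ _] := D1_sub.
apply: (finite_reduction TG_submodule TG_generated_ideal) => //.
- exact: D1_sub.
- by move=> m m' mv mm'; rewrite /e2 -!(role_perm _ mv mm') // subrr.
(* Every entry has the exclusive role 0, so [c] is empty and renaming suffices. *)
- move=> h c h_mono c0; exists (subst h [::]); split=> [I Iid u Iu|u Iu|m mv] /=.
  + exact: (subst_ideal _ _ Iid).
  + exact: subst_D1.
  + by rewrite /e2 /mon2 subst_y !(role_lift _ _ _ mv) // subrr.
Qed.

Lemma tier3 : reduces D3 D2.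
Proof.
apply: (finite_reduction TG_submodule TG_generated_ideal) => //.
- exact: D2_sub.
- move=> m m' mv mm'; rewrite /e3 -!(role_perm _ mv mm') //.
  by apply: D1_D2; apply: Id_D1; apply: mon3_perm; apply: roles_perm.
- move=> h c h_mono c0.
  (* Role 3 of [c] enters next to z by substitution, role 4 by bracketing from outside. *)
  exists (rmul (roles 5 c 4) \o subst h (roles 5 c 3)); split=> [I Iid u Iu|u Iu|m mv] /=.
  + by apply: (rmul_ideal _ Iid); apply: (subst_ideal _ _ Iid).
  + by apply: rmul_D2; apply: subst_D2.
  (* Substitution puts the new y's before the old ones, so the two sides agree only up to a
     permutation, hence modulo [Id]. *)
  + rewrite /e3 subst_mon3 {1}/mon3 -rmul_cat !(role_lift _ _ _ mv) // !roles_lift //.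
    by apply: D1_D2; apply: Id_D1; apply: mon3_perm; rewrite // perm_catC.
Qed.

Lemma tier4 : reduces D4 D3.
Proof.
have [D30 _ _] := D3_sub.
apply: (finite_reduction TG_submodule TG_generated_ideal) => //.
- exact: D3_sub.
- move=> m m' mv mm'; rewrite /e4 -!(role_perm _ mv mm') //.
  (* Swapping y's costs monomials of the third family, which [D3] absorbs. *)
  apply: (rmul_perm D3_sub _ (roles_perm _ _ mm')) => s1 i j s2.
  exact: (mon3_D3 _ s1 i j s2).
- move=> h c h_mono c0.
  exists (rmul (roles 2 c 1) \o subst h [::]); split=> [I Iid u Iu|u Iu|m mv] /=.
  + by apply: (rmul_ideal _ Iid); apply: (subst_ideal _ _ Iid).
  + by apply: rmul_D3; apply: subst_D3.
  + by rewrite /e4 subst_mon4 /mon4 -rmul_cat !(role_lift _ _ _ mv) // !roles_lift // subrr.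
Qed.

Lemma TG_generated_mono (S S' : set L) :
  S `<=` S' -> TG_generated homog S `<=` TG_generated homog S'.
Proof. by move=> SS' u Su I Iid S'I; apply: Su => // v /SS'/S'I. Qed.

Lemma TG_generated_sub (S : set L) : S `<=` J -> TG_generated homog S `<=` J.
Proof. by move=> SJ u; apply. Qed.

(** The remainder [f - s] stays in [J], so the next reduction applies to it. *)
Lemma reduces_trans D D' D'' : reduces D D' -> reduces D' D'' -> reduces D D''.
Proof.
move=> [S [Sfin SJ S_red]] [S' [S'fin S'J S'_red]].
exists (S `|` S'); split; first by rewrite finite_setU.
  by move=> u [/SJ|/S'J].
move=> f Jf Df; have [s Ss fs] := S_red f Jf Df.
have Jfs : J (f - s).
  apply: (submoduleB (TG_submodule J_ideal)) => //.
  exact: (TG_generated_sub SJ).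
have [s' Ss' fss'] := S'_red _ Jfs fs.
exists (s + s'); last by rewrite opprD addrA.
have [_ genD _] := TG_submodule (TG_generated_ideal (S `|` S')).
by apply: genD; [move: Ss | move: Ss']; apply: TG_generated_mono => u; [left | right].
Qed.

Lemma finite_basis : Id `<=` J -> exists S : set L,
  finite_set S /\ J = add_set (TG_generated homog S) Id.
Proof.
move=> IdJ; have [S [Sfin SJ S_red]] :=
  reduces_trans tier4 (reduces_trans tier3 (reduces_trans tier2 tier1)).
exists S; split=> //; apply/seteqP; split=> [f Jf|_ [s Ss [u Iu <-]]].
  have [s Ss Ifs] := S_red f Jf (D4_full f).
  by exists s => //; exists (f - s) => //; rewrite addrC subrK.
have [_ JD _] := TG_submodule J_ideal.
by apply: JD; [apply: TG_generated_sub Ss | apply: IdJ].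
Qed.

End Tiers.
End FreeGraded.

Theorem theorem3p47 (K : fieldType) (G : groupType) (g : G)
    (J : set (freeGLie K G)) :
  infinite_set [set: K] ->
  (forall a b : G, a * b = b * a)%g ->
  g <> 1%g ->
  TG_ideal (@fl_homog K G) J ->
  graded_identities (@fl_homog K G) (@Gamma K G g 1%g) `<=` J ->
  exists S : set (freeGLie K G),
    finite_set S /\
    J = add_set (TG_generated (@fl_homog K G) S)
                (graded_identities (@fl_homog K G) (@Gamma K G g 1%g)).
Proof.
by move=> _ _ g_neq1 J_ideal; apply: (finite_basis g_neq1).
Qed.
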